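(* Monotone submodular multiway partition (\textsc{Mono-Sub-MP}) admits a $4/3$-approximation: there is a (randomized) polynomial-time algorithm which, given an instance, returns a feasible partition whose expected objective value is at most $\frac{4}{3}$ times the optimum objective value.
   Context: An instance of \textsc{Mono-Sub-MP} consists of a finite ground set $V$, a set function $f:2^V\to\mathbb{R}_{\ge 0}$ that is non-negative, normalized ($f(\emptyset)=0$), monotone ($f(A)\le f(B)$ whenever $A\subseteq B$) and submodular ($f(A)+f(B)\ge f(A\cap B)+f(A\cup B)$ for all $A,B\subseteq V$), given by an evaluation oracle (which returns $f(S)$ on input $S$), and $k$ distinct terminals $t_1,\dots,t_k\in V$. A feasible solution is a partition $V_1,\dots,V_k$ of $V$ with $t_i\in V_i$ for every $i\in[k]$; the goal is to minimize $\sum_{i=1}^k f(V_i)$. Running time is polynomial in $|V|$, counting oracle calls as unit time. *)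

(* Defs.v *)
From mathcomp Require Import classical_sets reals.
From mathcomp Require Import all_boot all_order all_algebra.

Set Implicit Arguments.
Unset Strict Implicit.
Unset Printing Implicit Defensive.

Import Order.TTheory GRing.Theory Num.Theory.
Local Open Scope ring_scope.

Section MonoSubMP.
Variables (R : realType) (V : finType).
Implicit Types (f : {set V} -> R) (A B : {set V}).

Definition nonneg_setfun f := forall A, 0 <= f A.

Definition normalized_setfun f := f set0 = 0.

Definition monotone_setfun f := forall A B, A \subset B -> f A <= f B.

Definition submodular_setfun f :=
  forall A B, f (A :&: B) + f (A :|: B) <= f A + f B.

Variable k : nat.

Definition feasible (t : 'I_k -> V) (W : {ffun 'I_k -> {set V}}) : bool :=
  [&& [forall i, t i \in W i],
      [forall i, forall j, (i != j) ==> [disjoint W i & W j]]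
    & \bigcup_i W i == [set: V]].

Definition objective f (W : {ffun 'I_k -> {set V}}) : R := \sum_i f (W i).

(* An infimum over a finite set, attained as soon as a feasible partition
   exists: see opt_attained. *)
Definition opt f (t : 'I_k -> V) : R :=
  inf [set objective f W | W in [set W | feasible t W]]%classic.

Lemma feasible_ex (t : 'I_k -> V) :
  (0 < k)%N -> injective t -> exists W, feasible t W.
Proof.
move=> k0 tI.
pose g v := odflt (Ordinal k0) [pick i | t i == v].
exists [ffun i => [set v | g v == i]]; apply/and3P; split.
- apply/forallP => i; rewrite ffunE inE /g.
  by case: pickP => [j /eqP/tI -> //|/(_ i)]; rewrite eqxx.
- apply/forallP => i; apply/forallP => j; apply/implyP => ij.
  rewrite !ffunE -setI_eq0; apply/eqP/setP => v; rewrite !inE.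
  by apply: contraNF ij => /andP[/eqP <- /eqP <-].
- apply/eqP/setP => v; rewrite inE; apply/bigcupP; exists (g v) => //.
  by rewrite ffunE inE.
Qed.

Lemma opt_attained f (t : 'I_k -> V) : (0 < k)%N -> injective t ->
  exists2 W, feasible t W
    & opt f t = objective f W /\
      forall W', feasible t W' -> objective f W <= objective f W'.
Proof.
move=> k0 tI; have [W0 fW0] := feasible_ex k0 tI.
have [W fW minW] := @arg_minP _ _ _ W0 (feasible t) (objective f) fW0.
exists W => //; split=> //; apply/eqP; rewrite eq_le; apply/andP; split.
- apply: ge_inf; last by exists W.
  by exists (objective f W) => _ [W' fW' <-]; exact: minW.
- apply: lb_le_inf; first by exists (objective f W), W.
  by move=> _ [W' fW' <-]; exact: minW.
Qed.

End MonoSubMP.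

(* Real RAM with an evaluation oracle and fair coins, as a structured language.
   A store has integer cells (used for control, indices and addresses) and real
   cells, both addressed by naturals; nested NGet gives indirect addressing.
   Integers have no unit-cost multiplication, so after polynomially many steps
   they still have polynomial bit length. Arithmetic and comparison on reals
   are exact and unit-cost, but there is no rounding of reals to integers, and
   constants are naturals, so that no advice can be hidden in a real constant.
   Division by 0 returns 0. *)

Inductive nexp : Type :=
| NConst of nat
| NGet of nexp
| NAdd of nexp & nexp
| NSub of nexp & nexp.

Inductive rexp : Type :=
| RNat of nexp
| RGet of nexp
| RAdd of rexp & rexp
| RSub of rexp & rexp
| RMul of rexp & rexp
| RDiv of rexp & rexp.

Inductive bexp : Type :=
| NLe of nexp & nexp
| RLe of rexp & rexp
| BNot of bexp
| BAnd of bexp & bexp.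

Inductive cmd : Type :=
| Skip
| NSet of nexp & nexp
| RSet of nexp & rexp
| Query of nexp & nexp
| Flip of nexp
| Seq of cmd & cmd
| If of bexp & cmd & cmd
| While of bexp & cmd.

Section Semantics.
Variables (R : realType) (V : finType) (f : {set V} -> R).

Record store := Store { ncell : nat -> nat; rcell : nat -> R }.

Definition upd (T : Type) (m : nat -> T) (a : nat) (x : T) : nat -> T :=
  fun j => if j == a then x else m j.

Definition nset (s : store) a x := Store (upd (ncell s) a x) (rcell s).
Definition rset (s : store) a x := Store (ncell s) (upd (rcell s) a x).

Fixpoint neval (s : store) (e : nexp) : nat :=
  match e with
  | NConst c => c
  | NGet a => ncell s (neval s a)
  | NAdd e1 e2 => (neval s e1 + neval s e2)%N
  | NSub e1 e2 => (neval s e1 - neval s e2)%N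
  end.

Fixpoint reval (s : store) (e : rexp) : R :=
  match e with
  | RNat a => (neval s a)%:R
  | RGet a => rcell s (neval s a)
  | RAdd e1 e2 => reval s e1 + reval s e2
  | RSub e1 e2 => reval s e1 - reval s e2
  | RMul e1 e2 => reval s e1 * reval s e2
  | RDiv e1 e2 => reval s e1 / reval s e2
  end.

Fixpoint beval (s : store) (e : bexp) : bool :=
  match e with
  | NLe e1 e2 => (neval s e1 <= neval s e2)%N
  | RLe e1 e2 => reval s e1 <= reval s e2
  | BNot b => ~~ beval s b
  | BAnd b1 b2 => beval s b1 && beval s b2
  end.

(* Elements of V are named 0, ..., #|V| - 1 through enum_rank; a set is passed
   to the oracle as the #|V| consecutive integer cells of its indicator. *)
Definition read_set (s : store) (a : nat) : {set V} :=
  [set v | (0 < ncell s (a + enum_rank v))%N].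

(* The list is the stack of commands still to be executed; the machine has
   halted when it is empty. *)
Definition config := (seq cmd * store)%type.

(* One unit of time. The coin b is fresh at every step and only Flip looks
   at it. *)
Definition step (cfg : config) (b : bool) : config :=
  let: (cs, s) := cfg in
  match cs with
  | [::] => ([::], s)
  | Skip :: cs' => (cs', s)
  | NSet a e :: cs' => (cs', nset s (neval s a) (neval s e))
  | RSet a e :: cs' => (cs', rset s (neval s a) (reval s e))
  | Query a e :: cs' => (cs', rset s (neval s a) (f (read_set s (neval s e))))
  | Flip a :: cs' => (cs', nset s (neval s a) b)
  | Seq c1 c2 :: cs' => ([:: c1, c2 & cs'], s)
  | If e c1 c2 :: cs' => ((if beval s e then c1 else c2) :: cs', s)
  | While e c :: cs' =>
      ((if beval s e then [:: c, While e c & cs'] else cs'), s)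
  end.

Variables (k : nat) (t : 'I_k -> V).

(* Cell 0 holds #|V|, cell 1 holds k, cells 2, ..., k + 1 hold the terminals;
   all other cells are 0. The function f is not part of the store: it is
   accessible only through Query. *)
Definition init_store : store :=
  Store (fun j => nth 0%N [:: #|V|, k & [seq nat_of_ord (enum_rank (t i))
                                        | i <- enum 'I_k]] j)
        (fun=> 0).

Definition run (p : cmd) (coins : seq bool) : config :=
  foldl step ([:: p], init_store) coins.

Definition halted (cfg : config) : bool := nilp cfg.1.

(* Cell j < #|V| of the final store holds the (0-based) index of the part to
   which the j-th element of V is assigned. *)
Definition output (cfg : config) : {ffun 'I_k -> {set V}} :=
  [ffun i : 'I_k => [set v | ncell cfg.2 (enum_rank v) == i]].

End Semantics.

Arguments output {R V} k cfg.

Definition expectation_coins (R : realType) (T : nat)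
    (X : T.-tuple bool -> R) : R :=
  (\sum_(r : T.-tuple bool) X r) / 2 ^+ T.

(* Main.v *)
(* The relaxation gives each element v a point (x_j(v))_j of the simplex, the
   terminal t_j sitting at the j-th vertex, and minimizes the sum of the Lovasz
   extensions of f at the vectors x_j.

   Rounding: for a threshold c, part j receives the elements with x_j(v) >= c
   and a fixed part i0 receives in addition the set U(c) of the elements whose
   coordinates are all below c. For c uniform in (1/4, 1] the expected cost is
   at most 4/3 of the relaxed value minus f({t_i0}) / 3: what remains of 4/3 x_j
   beyond the probability that x_j(v) >= c is 4/3 min(x_j, 1/4), and the sum over
   j of min(x_j(v), 1/4) is at least 1 - max(1/4, max_j x_j(v)), so that these
   remainders pay for f(U(c)) by submodularity. The term f({t_i0}) / 3 is gained
   because t_i0 already belongs to the part that absorbs U(c).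

   This slack makes an approximate solution of the relaxation sufficient. With
   n = #|V|, if some f({t_i}) is at least f(V) / (3n), then an additive error
   f(V) / (12n) is harmless; otherwise giving everything to one terminal costs at
   most 4/3 f(V), and f(V) is at most the optimum. The relaxation is solved up to
   this error by the multiplicative update
     x_j(v) <- x_j(v) (1 + (sum_i x_i(v) w_i(v) - w_j(v)) / (24 n^3 f(V))),
   w_j being the greedy subgradient at x_j, which stays in the simplex. While
   the relaxed value exceeds the optimum by more than f(V) / (12n), the product
   over v of the coordinates x_j(v) selected by an optimal partition grows by a
   factor 1 + 1 / (576 n^4); as it starts above k^-n and never exceeds 1, one of
   the first 576 n^6 iterates is good. The algorithm is deterministic: it rounds
   every iterate with every i0 and every threshold and keeps the cheapest
   partition. *)

Require Import Defs.
From mathcomp Require Import classical_sets reals.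
From mathcomp Require Import all_boot all_order all_algebra.
From mathcomp Require Import zify ring lra.

Set Implicit Arguments.
Unset Strict Implicit.
Unset Printing Implicit Defensive.

Import Order.TTheory GRing.Theory Num.Theory.
Local Open Scope ring_scope.

(** * Greedy weights and step integrals *)

Section GreedyWeights.
Variables (R : realType) (V : finType) (f : {set V} -> R).
Hypothesis fN : normalized_setfun f.
Hypothesis fM : monotone_setfun f.
Hypothesis fS : submodular_setfun f.
Implicit Types (key y : V -> R) (u v : V) (S : {set V}).

(** Larger keys come first; breaking ties by [enum_rank] makes this a total order. *)
Definition before key u v : bool :=
  (key v < key u) || (key u == key v) && (enum_rank u <= enum_rank v)%N.

Definition prefix key v : {set V} := [set u | before key u v].

(** Edmonds' greedy vertex of the base polytope of [f] for this order, hence a subgradient of the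
    Lovasz extension at [key]. *)
Definition greedy key v : R := f (prefix key v) - f (prefix key v :\ v).

Lemma before_refl key v : before key v v.
Proof. by rewrite /before eqxx leqnn orbT. Qed.

Lemma before_total key u v : before key u v || before key v u.
Proof.
rewrite /before; case: (ltgtP (key u) (key v)) => //= _.
by rewrite ?orbT // leq_total.
Qed.

Lemma before_trans key u v w :
  before key u v -> before key v w -> before key u w.
Proof.
rewrite /before => /orP[uv|/andP[/eqP -> uv]] /orP[vw|/andP[/eqP <- vw]].
- by rewrite (lt_trans vw uv).
- by rewrite uv.
- by rewrite vw.
- by rewrite eqxx (leq_trans uv vw) orbT.
Qed.

Lemma before_anti key u v : before key u v -> before key v u -> u = v.
Proof.
rewrite /before; case: (ltgtP (key u) (key v)) => //= _ uv vu.
by apply: enum_rank_inj; apply/val_inj/eqP; rewrite eqn_leq uv vu.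
Qed.

Lemma before_ge key u v : before key u v -> key v <= key u.
Proof. by case/orP => [/ltW //|/andP[/eqP -> _]]. Qed.

Lemma in_prefix key v : v \in prefix key v.
Proof. by rewrite inE before_refl. Qed.

Lemma greedy_ge0 key v : 0 <= greedy key v.
Proof. by rewrite subr_ge0 fM // subD1set. Qed.

Lemma last_of key S v0 : v0 \in S ->
  exists2 v, v \in S & forall u, u \in S -> before key u v.
Proof.
move=> v0S; case: (@arg_maxnP _ v0 (mem S) (fun v => #|prefix key v|) v0S).
move=> v vS vmax; exists v => // u uS.
case: (eqVneq u v) => [->|uv]; first exact: before_refl.
have /orP[//|vu] := before_total key u v.
have : (#|prefix key v| < #|prefix key u|)%N.
  apply/proper_card/properP; split.
    by apply/subsetP => w; rewrite !inE => /before_trans; apply.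
  exists u; first exact: in_prefix.
  by rewrite inE; apply/negP => /before_anti /(_ vu)/eqP; rewrite (negPf uv).
by rewrite ltnNge; move: (vmax _ uS) => /= ->.
Qed.

(** Remove the last element [v] of [S]: submodularity for [S] and [prefix key v :\ v] bounds the
    weight of [v] by [f S - f (S :\ v)]. *)
Lemma sum_greedy_le key S : \sum_(v in S) greedy key v <= f S.
Proof.
move: {2}#|S| (leqnn #|S|) => m; elim: m S => [|m IH] S.
  by rewrite leqn0 cards_eq0 => /eqP ->; rewrite big_set0 fN.
case: (set_0Vmem S) => [->|[v0 v0S] Sm]; first by rewrite big_set0 fN.
have [v vS vlast] := last_of key v0S.
rewrite (big_setD1 v) //=.
have /IH {}IH : (#|S :\ v| <= m)%N by move: Sm; rewrite (cardsD1 v) vS.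
have := fS S (prefix key v :\ v).
have -> : S :&: (prefix key v :\ v) = S :\ v.
  apply/setP => u; rewrite !inE; case: (boolP (u \in S)) => uS /=.
    by rewrite vlast // andbT.
  by rewrite andbF.
have -> : S :|: (prefix key v :\ v) = prefix key v.
  apply/setP => u; rewrite !inE; case: (boolP (u \in S)) => uS /=.
    by rewrite vlast.
  by case: eqP => // uv; case/negP: uS; rewrite uv.
rewrite /greedy; lra.
Qed.

(** Such a set is the prefix of its last element, so the marginal values telescope. *)
Lemma sum_greedy_eq key S :
  (forall u v, v \in S -> key v <= key u -> u \in S) ->
  \sum_(v in S) greedy key v = f S.
Proof.
move=> Sdown.
(* Closure is weakened to [before]: removing the last element may split a class of equal keys, and
   only this form survives the induction. *)
have {Sdown} : forall u v, v \in S -> before key u v -> u \in S.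
  by move=> u v vS /before_ge; exact: Sdown.
move: {2}#|S| (leqnn #|S|) => m; elim: m S => [|m IH] S.
  by rewrite leqn0 cards_eq0 => /eqP -> _; rewrite big_set0 fN.
case: (set_0Vmem S) => [->|[v0 v0S] Sm Sdown]; first by rewrite big_set0 fN.
have [v vS vlast] := last_of key v0S.
have SE : S = prefix key v.
  by apply/setP => u; rewrite inE; apply/idP/idP; [exact: vlast|exact: Sdown].
rewrite (big_setD1 v) //= IH; first by rewrite /greedy -SE addrNK.
  by move: Sm; rewrite (cardsD1 v) vS.
move=> u w; rewrite !inE => /andP[wv wS] uw; rewrite (Sdown u w) // andbT.
apply: contraNneq wv => uv; rewrite uv in uw.
by rewrite (before_anti uw (vlast _ wS)).
Qed.

Lemma sum_greedy_setT key : \sum_v greedy key v = f setT.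
Proof.
rewrite -(@sum_greedy_eq key setT) ?big_setT //.
by apply: eq_bigl => v; rewrite inE.
Qed.

Lemma greedy_le key v : greedy key v <= f setT.
Proof.
rewrite -(sum_greedy_setT key) (bigD1 v) //= lerDl sumr_ge0 // => *.
exact: greedy_ge0.
Qed.

End GreedyWeights.

Section Levels.
Variable R : realType.
Implicit Types (a b y c : R) (s vals : seq R) (G H : R -> R).

(* The integral over [a, last a s] of the step function equal to G t on the
   interval ending at t, for t in s. *)
Fixpoint wsum a s G : R :=
  if s is t :: s' then (t - a) * G t + wsum t s' G else 0.

Lemma wsumD a s G H :
  wsum a s (fun t => G t + H t) = wsum a s G + wsum a s H.
Proof. by elim: s a => [|t s IH] a /=; rewrite ?addr0 // IH; ring. Qed.

Lemma wsumZ a s c G : wsum a s (fun t => c * G t) = c * wsum a s G.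
Proof. by elim: s a => [|t s IH] a /=; rewrite ?mulr0 // IH; ring. Qed.

Lemma wsum_cst a s c : wsum a s (fun=> c) = (last a s - a) * c.
Proof. by elim: s a => [|t s IH] a /=; rewrite ?subrr ?mul0r // IH; ring. Qed.

Lemma wsum_sum (I : finType) a s (G : I -> R -> R) :
  wsum a s (fun t => \sum_i G i t) = \sum_i wsum a s (G i).
Proof.
elim: s a => [|t s IH] a /=; first by rewrite big1.
by rewrite IH mulr_sumr -big_split.
Qed.

Lemma eq_wsum a s G H : {in s, G =1 H} -> wsum a s G = wsum a s H.
Proof.
elim: s a => [//|t s IH] a GH /=; rewrite GH ?mem_head // IH // => u us.
by rewrite GH // inE us orbT.
Qed.

Lemma ler_wsum a s G H : path <%R a s -> {in s, forall t, G t <= H t} ->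
  wsum a s G <= wsum a s H.
Proof.
elim: s a => [//|t s IH] a /= /andP[at_ ts] GH.
apply: lerD.
  by apply: ler_wpM2l; [rewrite subr_ge0 ltW|rewrite GH ?mem_head].
by apply: IH => // u us; apply: GH; rewrite inE us orbT.
Qed.

(** As [y] is a breakpoint, the indicator is constant on each interval and equal to its value at the
    right end. *)
Lemma wsum_indicator a s y : path <%R a s -> y \in a :: s ->
  wsum a s (fun t => (t <= y)%R%:R) = y - a.
Proof.
elim: s a y => [|t s IH] a y /=; first by rewrite inE => _ /eqP ->; rewrite subrr.
move=> /andP[at_ ts]; have tmin u : u \in s -> t < u.
  by move: ts; rewrite (path_sortedE lt_trans) => /andP[/allP + _] us; apply.
rewrite in_cons => /orP[/eqP -> |ys].
  rewrite [t <= a]leNgt at_ /= mulr0 add0r subrr.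
  under eq_wsum => u us do rewrite leNgt (lt_trans at_ (tmin _ us)) /=.
  by rewrite wsum_cst mulr0.
rewrite IH //; have -> : t <= y; last by rewrite mulr1 addrC addrA addrNK.
by move: ys; rewrite inE => /orP[/eqP ->//|/tmin/ltW].
Qed.

(** The value [b] is added so that the integral extends up to [b]. *)
Definition levels a b vals :=
  sort <=%R (undup [seq y <- b :: vals | a < y <= b]).

Lemma mem_levels a b vals y :
  (y \in levels a b vals) = (a < y <= b) && (y \in b :: vals).
Proof. by rewrite mem_sort mem_undup mem_filter. Qed.

Lemma path_levels a b vals : path <%R a (levels a b vals).
Proof.
rewrite (path_sortedE lt_trans); apply/andP; split.
  by apply/allP => y; rewrite mem_levels => /andP[/andP[]].
by rewrite lt_sorted_uniq_le sort_uniq undup_uniq sort_le_sorted.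
Qed.

Lemma last_levels a b vals : a < b -> last a (levels a b vals) = b.
Proof.
move=> ab; have bl : b \in levels a b vals.
  by rewrite mem_levels ab lexx mem_head.
apply/eqP; rewrite eq_le; apply/andP; split.
  have := mem_last a (levels a b vals).
  by rewrite inE mem_levels => /orP[/eqP -> |/andP[/andP[]//]]; rewrite ltW.
move: bl (path_levels a b vals); move: (levels a b vals) => s.
elim: s a {ab} => [//|t s IH] a; rewrite inE /= => /orP[/eqP <-|bs] /andP[_ ts].
  elim: s b ts {IH} => [//|u s IH] b /= /andP[bu us].
  exact: le_trans (ltW bu) (IH _ us).
exact: IH.
Qed.

Definition clamp a b y : R := Num.max a (Num.min y b).

(** Layer-cake formula: [c v] is counted over the thresholds of (a, b] up to [y v]. *)
Lemma wsum_layer (V : finType) a b vals (c y : V -> R) : a < b ->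
  (forall v, y v \in vals) ->
  wsum a (levels a b vals) (fun t => \sum_(v | t <= y v) c v)
  = \sum_v c v * (clamp a b (y v) - a).
Proof.
move=> ab yvals.
under eq_wsum => t _ do rewrite big_mkcond /=.
rewrite wsum_sum; apply: eq_bigr => v _.
rewrite -(@wsum_indicator a (levels a b vals)); first last.
- rewrite inE mem_levels inE /clamp; have := yvals v.
  case: (leP (y v) b) => yb yvals_v.
    by case: (ltgtP a (y v)) => ay; rewrite ?eqxx // ay yb yvals_v !orbT.
  by rewrite (max_r (ltW ab)) ab lexx eqxx !orbT.
- exact: path_levels.
rewrite -wsumZ; apply: eq_wsum => t; rewrite mem_levels => /andP[/andP[at_ tb] _].
have -> : (t <= clamp a b (y v)) = (t <= y v).
  by rewrite /clamp le_max le_min tb andbT leNgt at_.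
by case: ifP; rewrite ?mulr1 ?mulr0.
Qed.

End Levels.

(** * Threshold rounding *)

Section Rounding.
Variables (R : realType) (V : finType) (f : {set V} -> R).
Hypothesis fN : normalized_setfun f.
Hypothesis fM : monotone_setfun f.
Hypothesis fS : submodular_setfun f.
Variables (k : nat) (t : 'I_k -> V).
Implicit Types (x : 'I_k -> V -> R) (m p : V -> 'I_k) (i j : 'I_k) (v : V).

Record fractional x : Prop := Fractional {
  frac_ge0 : forall j v, 0 <= x j v;
  frac_sum : forall v, \sum_j x j v = 1;
  frac_terminal : forall i j, x j (t i) = (j == i)%:R }.

(** For each [j] the sum over [v] is the Lovasz extension of [f] at [x j], because [greedy f (x j)]
    is tight on the superlevel sets of [x j]. *)
Definition relaxation x : R := \sum_v \sum_j x j v * greedy f (x j) v.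

Definition parts p : {ffun 'I_k -> {set V}} := [ffun j => [set v | p v == j]].

Definition argmax x m := forall v j, x j v <= x (m v) v.

(** Threshold sets may overlap when c <= 1/2; using only the largest coordinate makes the parts
    disjoint and keeps part j, for j != i0, inside its threshold set. *)
Definition rounding x m i0 (c : R) v := if c <= x (m v) v then m v else i0.

Lemma frac_le1 x j v : fractional x -> x j v <= 1.
Proof.
case=> x0 x1 _; rewrite -(x1 v) (bigD1 j) //= lerDl.
by apply: sumr_ge0 => i _; exact: x0.
Qed.

Lemma argmax_terminal x m i : fractional x -> argmax x m -> m (t i) = i.
Proof.
case=> _ _ xt xm; have := xm (t i) i; rewrite !xt eqxx.
by case: eqP => //= _; rewrite ?ler10.
Qed.

(* As 4 y >= x / y' whenever x <= y', 1/4 <= y' and y = min x (1/4), the sum is at least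
   1 / (4 y'), with y' the largest coordinate. *)
Lemma sum_min_quarter x m v : fractional x -> argmax x m ->
  1 - Num.max (1 / 4) (x (m v) v) <= \sum_j Num.min (x j v) (1 / 4).
Proof.
move=> xF xm; set M := x (m v) v; have x0 := frac_ge0 xF.
case: (leP M (1 / 4)) => M4.
  have -> : \sum_j Num.min (x j v) (1 / 4) = 1.
    rewrite -[RHS](frac_sum xF v); apply: eq_bigr => j _.
    by apply: min_l; exact: le_trans (xm v j) M4.
  by rewrite lerBlDr lerDl; lra.
have M0 : 0 < M by lra.
have : \sum_j x j v * (1 / (4 * M)) <= \sum_j Num.min (x j v) (1 / 4).
  apply: ler_sum => j _; rewrite mulrA mulr1 ler_pdivrMr ?mulr_gt0 //.
  have xM : x j v <= M := xm v j.
  case: (leP (x j v) (1 / 4)) => xj; last by lra.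
  have : 0 <= x j v * (4 * M - 1) by rewrite mulr_ge0 ?x0 //; lra.
  lra.
rewrite -mulr_suml (frac_sum xF) mul1r; apply: le_trans.
rewrite ler_pdivlMr ?mulr_gt0 //.
have : 0 <= (2 * M - 1) ^+ 2 by exact: sqr_ge0.
lra.
Qed.

(** Linear optimization over the submodular polyhedron. By layers it suffices to compare both sides
    on the superlevel sets of [y]; these are upward closed for [key], so the greedy weights attain
    [f] there. *)
Lemma greedy_max (c y key : V -> R) :
  (forall S : {set V}, \sum_(v in S) c v <= f S) ->
  (forall v, 0 <= y v) ->
  (forall u v, key v <= key u -> y v <= y u) ->
  \sum_v c v * y v <= \sum_v greedy f key v * y v.
Proof.
move=> cf y0 ykey.
pose b := 1 + \sum_v y v; pose vals := [seq y v | v <- enum V].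
have yb v : y v <= b.
  by rewrite /b (bigD1 v) //= addrCA lerDl addr_ge0 // sumr_ge0.
have b0 : 0 < b by rewrite /b ltr_wpDr // sumr_ge0.
have yvals v : y v \in vals by rewrite map_f ?mem_enum.
have E (d : V -> R) : \sum_v d v * y v =
    wsum 0 (levels 0 b vals) (fun s => \sum_(v | s <= y v) d v).
  rewrite wsum_layer //; apply: eq_bigr => v _.
  by rewrite /clamp min_l // max_r // subr0.
rewrite !E; apply: ler_wsum => [|s _]; first exact: path_levels.
have S_E (d : V -> R) :
    \sum_(v | s <= y v) d v = \sum_(v in [set v | (s <= y v)%R]) d v.
  by apply: eq_bigl => v; rewrite inE.
rewrite !S_E (sum_greedy_eq fN) // => u v; rewrite !inE => sv /ykey.
exact: le_trans.
Qed.

Section Threshold.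
Variables (x : 'I_k -> V -> R) (m : V -> 'I_k) (i0 : 'I_k).
Hypothesis xF : fractional x.
Hypothesis xm : argmax x m.

(** The terminal [t i0] is added so that this set meets the threshold set of [i0]; submodularity
    gains the value of the intersection. *)
Definition unassigned (c : R) : {set V} :=
  t i0 |: [set v | x (m v) v < c].

Definition threshold_cost (c : R) : R :=
  \sum_j f [set v | c <= x j v] + f (unassigned c) - f [set t i0].

(* Submodularity for the part i0: the threshold set of i0 and the unassigned
   elements share t i0. *)
Lemma rounding_cost c : 0 < c <= 1 ->
  objective f (parts (rounding x m i0 c)) <= threshold_cost c.
Proof.
move=> /andP[c0 c1]; rewrite /objective /threshold_cost.
rewrite (bigD1 i0) //= [X in _ <= X + _ - _](bigD1 i0) //=.
have others : \sum_(j | j != i0) f (parts (rounding x m i0 c) j) <=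
    \sum_(j | j != i0) f [set v | c <= x j v].
  apply: ler_sum => j ji; apply: fM; apply/subsetP => v.
  rewrite ffunE !inE /rounding; case: ifP => [cx /eqP <- //|_ /eqP ij].
  by rewrite ij eqxx in ji.
have := fS [set v | c <= x i0 v] (unassigned c).
have tI : f [set t i0] <= f ([set v | c <= x i0 v] :&: unassigned c).
  apply: fM; apply/subsetP => v; rewrite !inE => /eqP ->.
  by rewrite (frac_terminal xF) !eqxx c1.
have own : f (parts (rounding x m i0 c) i0) <=
    f ([set v | c <= x i0 v] :|: unassigned c).
  apply: fM; apply/subsetP => v; rewrite ffunE !inE /rounding.
  case: leP => [cx /eqP mv|_ _]; last by rewrite !orbT.
  by rewrite -mv cx.
lra.
Qed.

(* Average of threshold_cost over a uniform threshold in (1/4, 1]. The chain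
   of the sets unassigned c carries the weights om, whose order starts with
   t i0. *)
Lemma threshold_average (rho : R) :
  (forall c : R, 0 < c <= 1 -> rho <= threshold_cost c) ->
  rho <= 4 / 3 * relaxation x - f [set t i0] / 3.
Proof.
move=> rhoC.
(* [M] vanishes at [t i0], which thus lies below every positive threshold. All other keys are at
   most 0, so the key 1 puts [t i0] first. *)
pose M v : R := if v == t i0 then 0 else x (m v) v.
pose key v : R := if v == t i0 then 1 else - x (m v) v.
pose om := greedy f key.
have x0 := frac_ge0 xF; have x1 j v : x j v <= 1 := frac_le1 j v xF.
have om_le (S : {set V}) : \sum_(v in S) om v <= f S by exact: sum_greedy_le.
have om_t : om (t i0) = f [set t i0].
  rewrite -(@sum_greedy_eq _ _ f fN key [set t i0]) ?big_set1 // => u v.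
  rewrite !inE /key => /eqP ->; rewrite eqxx; case: eqP => // _ h.
  by have := x0 (m u) u; lra.
have om0 v : 0 <= om v := greedy_ge0 fM key v.
(* Passing to the complement yields superlevel sets of [M], to which [wsum_layer] applies. *)
have om_U c : 0 < c ->
    f (unassigned c) = \sum_v om v - \sum_(v | c <= M v) om v.
  move=> c0; rewrite [in RHS](bigID (fun v => c <= M v)) /= addrAC subrr add0r.
  rewrite -(@sum_greedy_eq _ _ f fN key) => [|u v].
    apply: eq_bigl => v; rewrite !inE /M -ltNge.
    by case: eqP => //= _; rewrite c0.
  rewrite !inE /key; case: (eqVneq v (t i0)) => [_ _|_ /= vc].
    by case: eqP => //= _ h; have := x0 (m u) u; lra.
  by case: eqP => //= _ h; rewrite (le_lt_trans _ vc) // -lerN2.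
pose w j := greedy f (x j).
pose vals := [seq x i v | i <- enum 'I_k, v <- enum V] ++ map M (enum V).
have xvals j v : x j v \in vals.
  by rewrite mem_cat; apply/orP; left; apply/allpairsP; exists (j, v);
     rewrite /= !mem_enum.
have Mvals v : M v \in vals by rewrite mem_cat map_f ?mem_enum ?orbT.
pose s := levels (1 / 4) 1 vals.
have q1 : (1 / 4 : R) < 1 by lra.
pose G c := \sum_j (\sum_(v | c <= x j v) w j v)
  + (-1 * (\sum_(v | c <= M v) om v) + (\sum_v om v - f [set t i0])).
have rhoG : 3 / 4 * rho <= wsum (1 / 4) s G.
  have -> : 3 / 4 * rho = wsum (1 / 4) s (fun=> rho).
    by rewrite wsum_cst last_levels //; lra.
  apply: ler_wsum => [|c]; first exact: path_levels.
  rewrite mem_levels => /andP[/andP[c4 c1] _]; have c0 : 0 < c by lra.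
  apply: (le_trans (rhoC c _)); first by rewrite c0.
  rewrite /threshold_cost /G om_U //.
  rewrite [X in X + _ - _](eq_bigr (fun j => \sum_(v | c <= x j v) w j v)).
    lra.
  move=> j _; rewrite -(@sum_greedy_eq _ _ f fN (x j)) => [|u v].
    by apply: eq_bigl => v; rewrite inE.
  by rewrite !inE => cv /(le_trans cv).
(* [high j v] is the length of the thresholds in (1/4, 1] at which [v] enters the set of [j];
   [low j v] is the remainder that pays for the unassigned elements. *)
pose high j v := clamp (1 / 4) 1 (x j v) - 1 / 4.
pose low j v := Num.min (x j v) (1 / 4).
have x_split j v : x j v = low j v + high j v.
  rewrite /low /high /clamp (min_l (x1 j v)).
  by case: (leP (x j v) (1 / 4)) => h; rewrite ?subrr ?addr0 //; lra.
have G_E : wsum (1 / 4) s G = \sum_j \sum_v w j v * high j v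
    - \sum_v om v * (clamp (1 / 4) 1 (M v) - 1 / 4)
    + 3 / 4 * (\sum_v om v - f [set t i0]).
  rewrite !wsumD wsumZ !wsum_cst !last_levels // wsum_layer //.
  have -> : wsum (1 / 4) s (fun c => \sum_j \sum_(v | c <= x j v) w j v) =
     \sum_j \sum_v w j v * high j v.
    by rewrite wsum_sum; apply: eq_bigr => j _; rewrite wsum_layer.
  by lra.
have relax_E : relaxation x =
    \sum_j \sum_v w j v * low j v + \sum_j \sum_v w j v * high j v.
  rewrite /relaxation exchange_big -big_split; apply: eq_bigr => j _ /=.
  rewrite -big_split; apply: eq_bigr => v _ /=.
  by rewrite -mulrDr -x_split mulrC.
have om_w : \sum_j \sum_v om v * low j v <= \sum_j \sum_v w j v * low j v.
  apply: ler_sum => j _; apply: greedy_max => // [v|u v].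
    by rewrite /low le_min x0; lra.
  by move=> xvu; rewrite /low le_min !ge_min xvu lexx orbT.
(* Away from [t i0] the coefficient of [om v] is nonnegative by [sum_min_quarter]; at [t i0] it is
   1/4 + 0 - 3/4 = -1/2. *)
have om_low : - (om (t i0) / 2) <= \sum_j \sum_v om v * low j v
    + \sum_v om v * (clamp (1 / 4) 1 (M v) - 1 / 4) - 3 / 4 * \sum_v om v.
  rewrite exchange_big /= mulr_sumr -big_split /= -sumrB (bigD1 (t i0)) //=.
  have -> : clamp (1 / 4) 1 (M (t i0)) = 1 / 4.
    by rewrite /clamp /M eqxx min_l ?max_l //; lra.
  rewrite -mulr_sumr (bigD1 i0) //= big1 => [|j ji]; last first.
    by rewrite /low (frac_terminal xF) (negPf ji) mulr0n min_l //; lra.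
  have -> : low i0 (t i0) = 1 / 4.
    by rewrite /low (frac_terminal xF) eqxx mulr1n min_r //; lra.
  have : 0 <= \sum_(v | v != t i0) (\sum_j om v * low j v
     + om v * (clamp (1 / 4) 1 (M v) - 1 / 4) - 3 / 4 * om v).
    apply: sumr_ge0 => v vt; rewrite -mulr_sumr /M (negPf vt).
    have := sum_min_quarter v xF xm; rewrite -/(low _ v) /clamp.
    rewrite [Num.min (x (m v) v) 1]min_l // => h.
    rewrite [3 / 4 * _]mulrC -mulrDr -mulrBr mulr_ge0 //.
    by rewrite /low; lra.
  lra.
lra.
Qed.
End Threshold.

(** The rounding depends on [c] only through which top coordinates reach it, so the top coordinates
    suffice as thresholds. The cheapest of them is below every [threshold_cost c], hence below the
    average. *)
Lemma rounding_ex x m i0 : fractional x -> argmax x m ->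
  exists u, objective f (parts (rounding x m i0 (x (m u) u)))
            <= 4 / 3 * relaxation x - f [set t i0] / 3.
Proof.
move=> xF xm.
pose cost u := objective f (parts (rounding x m i0 (x (m u) u))).
have [u _ umin] := @arg_minP _ _ _ (t i0) xpredT cost isT.
exists u; apply: (threshold_average xF xm) => c /andP[c0 c1].
apply: le_trans (rounding_cost m i0 xF _); last by rewrite c0.
pose P v := c <= x (m v) v.
have Pt : P (t i0).
  by rewrite /P (argmax_terminal i0 xF xm) (frac_terminal xF) eqxx.
have [w Pw wmin] := @arg_minP _ _ _ (t i0) P (fun v => x (m v) v) Pt.
apply: le_trans (umin w isT) _; rewrite /cost.
suff -> : parts (rounding x m i0 (x (m w) w)) = parts (rounding x m i0 c) by [].
apply/ffunP => j; rewrite !ffunE; apply/setP => v; rewrite !inE /rounding.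
have -> // : (x (m w) w <= x (m v) v) = (c <= x (m v) v).
by apply/idP/idP => [|/wmin //]; exact: le_trans.
Qed.

End Rounding.

(** * Approximate solution of the relaxation *)

Section Descent.
Variables (R : realType) (V : finType) (f : {set V} -> R).
Hypothesis fN : normalized_setfun f.
Hypothesis fM : monotone_setfun f.
Hypothesis fS : submodular_setfun f.
Variables (k : nat) (t : 'I_k -> V).
Hypothesis k0 : (0 < k)%N.
Hypothesis tI : injective t.
Implicit Types (x : 'I_k -> V -> R) (m p c : V -> 'I_k) (i j : 'I_k) (v : V).

Definition start j v : R :=
  if [exists i, t i == v] then (t j == v)%:R else 1 / k%:R.

Definition average x v : R := \sum_j x j v * greedy f (x j) v.

(** This scale keeps the second-order loss in [potential_update] within half of the first-order
    gain. The factors are arranged as in [constants_prog]. *)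
Definition step_denominator : R :=
  24%:R * #|V|%:R * #|V|%:R * #|V|%:R * f setT.

Definition change x j v : R :=
  (average x v - greedy f (x j) v) / step_denominator.

Definition update x j v : R := x j v * (1 + change x j v).

Lemma k_le_cardV : (k <= #|V|)%N.
Proof. by rewrite -[X in (X <= _)%N]card_ord; exact: leq_card tI. Qed.

Lemma cardV_gt0 : (0 < #|V|)%N.
Proof. exact: leq_trans k0 k_le_cardV. Qed.

Lemma cardV_ge1 : 1 <= #|V|%:R :> R.
Proof. by rewrite ler1n cardV_gt0. Qed.

Lemma start_fractional : fractional t start.
Proof.
have k1 : 0 < k%:R :> R by rewrite ltr0n.
split=> [j v|v|i j]; rewrite /start.
- by case: ifP => _; [exact: ler0n|rewrite divr_ge0].
  - case: (boolP [exists i, t i == v]) => [/existsP[i /eqP <-]|_].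
    rewrite (bigD1 i) //= eqxx big1 ?addr0 // => j ji.
    by rewrite (inj_eq tI) (negPf ji).
  by rewrite sumr_const card_ord -[LHS]mulr_natr div1r mulVf ?gt_eqF.
- by rewrite (inj_eq tI) ifT //; apply/existsP; exists i.
Qed.

Lemma average_bounds x v : fractional t x -> 0 <= average x v <= f setT.
Proof.
move=> xF; have x0 := frac_ge0 xF; apply/andP; split.
  by apply: sumr_ge0 => j _; rewrite mulr_ge0 ?x0 ?greedy_ge0.
rewrite -[leRHS]mul1r -(frac_sum xF v) mulr_suml; apply: ler_sum => j _.
by rewrite ler_wpM2l ?x0 ?greedy_le.
Qed.

Lemma norm_change x j v : fractional t x ->
  `|change x j v| <= 1 / (24 * #|V|%:R ^+ 3).
Proof.
move=> xF; have n1 := cardV_ge1.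
have n3 : 0 < 24 * #|V|%:R ^+ 3 :> R by rewrite mulr_gt0 ?exprn_gt0 //; lra.
have := greedy_ge0 fM (x j) v; have := greedy_le fN fM (x j) v.
have /andP[] := average_bounds v xF.
rewrite /change /step_denominator; set B := f setT; set w := greedy _ _ _.
set a := average _ _ => a0 aB wB w0.
(* If [f setT] is 0, the division by 0 makes the change 0. *)
have [B0|B0] := eqVneq B 0; first by rewrite B0 mulr0 invr0 mulr0 normr0 divr_ge0 // ltW.
have {}B0 : 0 < B by rewrite lt_neqAle eq_sym B0; lra.
have -> : 24%:R * #|V|%:R * #|V|%:R * #|V|%:R * B = B * (24 * #|V|%:R ^+ 3).
  by ring.
rewrite normrM normfV [`|B * _|]gtr0_norm; last exact: mulr_gt0.
rewrite invfM mulrA; apply: ler_wpM2r; first by rewrite invr_ge0 ltW.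
rewrite ler_pdivrMr // mul1r ler_norml; apply/andP; split; lra.
Qed.

Lemma norm_change1 x j v : fractional t x -> `|change x j v| <= 1.
Proof.
move=> xF; apply: le_trans (norm_change j v xF) _.
have n1 := cardV_ge1; have n3 : 1 <= #|V|%:R ^+ 3 :> R by rewrite exprn_ege1.
by rewrite ler_pdivrMr ?mul1r; lra.
Qed.

(** The relative changes have mean 0 under the weights x_j(v), so the sum stays 1. At a terminal the
    mean is the weight of its own coordinate, so nothing moves. *)
Lemma update_fractional x : fractional t x -> fractional t (update x).
Proof.
move=> xF; split=> [j v|v|i j]; rewrite /update.
- rewrite mulr_ge0 ?(frac_ge0 xF) //.
  by have := norm_change1 j v xF; rewrite ler_norml => /andP[]; lra.
- under eq_bigr => j _ do rewrite mulrDr mulr1 mulrA.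
  rewrite big_split /= (frac_sum xF) -mulr_suml.
  under eq_bigr => j _ do rewrite mulrBr.
  by rewrite sumrB -mulr_suml (frac_sum xF) mul1r subrr mul0r addr0.
- rewrite (frac_terminal xF); case: eqP => [->|_]; last by rewrite mul0r.
  rewrite mul1r /change /average (bigD1 i) //= big1 => [|l li].
    by rewrite (frac_terminal xF) eqxx mul1r addr0 subrr mul0r addr0.
  by rewrite (frac_terminal xF) (negPf li) mul0r.
Qed.

Lemma iter_fractional s : fractional t (iter s update start).
Proof.
by elim: s => [|s IH] /=; [exact: start_fractional|exact: update_fractional].
Qed.

(** By induction: the cross term is at least [- 2 * |a i| * S], with [S] the sum of the other
    absolute values, and the square of [|a i| + S] absorbs it. *)
Lemma prod_1D_ge (I : Type) (s : seq I) (a : I -> R) :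
  \sum_(i <- s) `|a i| <= 1 ->
  1 + \sum_(i <- s) a i - (\sum_(i <- s) `|a i|) ^+ 2
    <= \prod_(i <- s) (1 + a i).
Proof.
elim: s => [|i s IH]; first by rewrite !big_nil => _; lra.
rewrite !big_cons; set S := \sum_(j <- s) _; set A := \sum_(j <- s) a j.
set P := \prod_(j <- s) _ => iS1.
have S0 : 0 <= S by exact: sumr_ge0.
have i0 : 0 <= `|a i| by [].
have {}IH : 1 + A - S ^+ 2 <= P by apply: IH; rewrite -/S; lra.
have AS : `|A| <= S by exact: ler_norm_sum.
have /andP[ai1 ai2] : - `|a i| <= a i <= `|a i| by rewrite -ler_norml.
have /andP[A1 A2] : - S <= A <= S by rewrite -ler_norml.
have h1 : (1 + a i) * (1 + A - S ^+ 2) <= (1 + a i) * P.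
  by apply: ler_wpM2l => //; lra.
have SS : S ^+ 2 <= S by rewrite expr2; nra.
have h2 : - (`|a i| * (S + S)) <= a i * (A - S ^+ 2).
  have : `|a i * (A - S ^+ 2)| <= `|a i| * (S + S).
    rewrite normrM ler_wpM2l // ler_norml; apply/andP; split; nra.
  by rewrite ler_norml => /andP[].
have h3 : 0 <= `|a i| ^+ 2 by exact: sqr_ge0.
rewrite sqrrD; lra.
Qed.

Lemma sum_parts c (g : 'I_k -> V -> R) :
  \sum_v g (c v) v = \sum_j \sum_(v in parts c j) g j v.
Proof.
rewrite (partition_big c predT) //=; apply: eq_bigr => j _.
rewrite ffunE; apply: eq_big => [v|v /eqP -> //]; by rewrite inE.
Qed.

Lemma sum_greedy_parts c x :
  \sum_v greedy f (x (c v)) v <= objective f (parts c).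
Proof.
rewrite (sum_parts c (fun j v => greedy f (x j) v)).
by apply: ler_sum => j _; exact: sum_greedy_le.
Qed.

Lemma setT_le_objective c : f setT <= objective f (parts c).
Proof.
(* With one common key the greedy weights of all parts add up to [f setT]. *)
have := sum_greedy_parts c (fun _ _ => 0).
by rewrite (sum_greedy_setT fN).
Qed.

Definition potential c x : R := \prod_v x (c v) v.

(** The relative changes selected by [c] sum to the excess of the relaxed value over the linearized
    cost of [c], divided by the denominator: at least 1 / (288 n^4). The second-order loss is at
    most (1 / (24 n^2))^2, half of this. *)
Lemma potential_update c x : fractional t x -> 0 < f setT ->
  objective f (parts c) + f setT / (12 * #|V|%:R) < relaxation f x ->
  (1 + 1 / (576 * #|V|%:R ^+ 4)) * potential c x <= potential c (update x).
Proof.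
move=> xF B0 xbad; have n1 := cardV_ge1.
pose n : R := #|V|%:R; pose r v := change x (c v) v.
have n0 : 0 < n by rewrite /n; lra.
have rE : \sum_v r v =
    (relaxation f x - \sum_v greedy f (x (c v)) v) / step_denominator.
  by rewrite /r /change -mulr_suml sumrB.
have D0 : 0 < step_denominator by rewrite /step_denominator !mulr_gt0 ?ltr0n ?cardV_gt0.
have r_ge : 1 / (288 * n ^+ 4) <= \sum_v r v.
  rewrite rE ler_pdivlMr //.
  have -> : 1 / (288 * n ^+ 4) * step_denominator = f setT / (12 * n).
    by rewrite /step_denominator -/n; field; rewrite gt_eqF.
  by have := sum_greedy_parts c x; rewrite -/n in xbad; lra.
have R_le : \sum_v `|r v| <= 1 / (24 * n ^+ 2).
  have -> : 1 / (24 * n ^+ 2) = \sum_(v : V) 1 / (24 * n ^+ 3).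
    by rewrite sumr_const -[LHS]mulr1 -mulr_natr -/n; field; rewrite gt_eqF.
  by apply: ler_sum => v _; exact: norm_change.
have R0 : 0 <= \sum_v `|r v| by exact: sumr_ge0.
have nn : 1 <= n ^+ 2 by rewrite exprn_ege1.
have R1 : \sum_v `|r v| <= 1.
  by apply: le_trans R_le _; rewrite ler_pdivrMr ?mul1r; lra.
have := prod_1D_ge R1; set P := \prod_(i <- _) _ => P_ge.
have sq : (\sum_v `|r v|) ^+ 2 <= 1 / (576 * n ^+ 4).
  have -> : 1 / (576 * n ^+ 4) = (1 / (24 * n ^+ 2)) ^+ 2.
    by field; rewrite gt_eqF.
  by apply: lerXn2r; rewrite // nnegrE // (le_trans R0).
have P1 : 1 + 1 / (576 * n ^+ 4) <= P.
  have -> : 1 + 1 / (576 * n ^+ 4) = 1 + 1 / (288 * n ^+ 4) - 1 / (576 * n ^+ 4).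
    by field; rewrite gt_eqF.
  lra.
have -> : potential c (update x) = potential c x * P by rewrite -big_split.
rewrite mulrC ler_wpM2l //.
by apply: prodr_ge0 => v _; exact: frac_ge0 xF _ _.
Qed.

Lemma bernoulli (d : R) s : 0 <= d -> 1 + s%:R * d <= (1 + d) ^+ s.
Proof.
move=> d0; elim: s => [|s IH]; first by rewrite mul0r addr0.
rewrite exprS; apply: le_trans (_ : (1 + d) * (1 + s%:R * d) <= _).
  have : 0 <= s%:R * d * d by rewrite !mulr_ge0.
  by rewrite -natr1; lra.
by rewrite ler_wpM2l //; lra.
Qed.

Definition iterations := (576 * #|V| ^ 6)%N.

Lemma iterations_gt0 : (0 < iterations)%N.
Proof. by rewrite muln_gt0 expn_gt0 cardV_gt0. Qed.

(** By Bernoulli every 576 n^4 factors contribute at least 2; there are n^2 such blocks, and k <= n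
    < 2^n. *)
Lemma growth :
  k%:R ^+ #|V| < (1 + 1 / (576 * #|V|%:R ^+ 4)) ^+ iterations :> R.
Proof.
have n0 : 0 < #|V|%:R :> R by have := cardV_ge1; lra.
have -> : iterations = ((576 * #|V| ^ 4) * (#|V| * #|V|))%N.
  by rewrite /iterations -mulnA mulnn -expnD.
rewrite exprM; set d := 1 / _.
have d0 : 0 <= d by rewrite divr_ge0 // mulr_ge0 // exprn_ge0 // ltW.
have two : 2 <= (1 + d) ^+ (576 * #|V| ^ 4).
  apply: le_trans (bernoulli _ d0); rewrite natrM natrX /d mulrA mulr1.
  by rewrite divff ?mulf_neq0 ?expf_neq0 ?gt_eqF //; lra.
apply: lt_le_trans (_ : 2 ^+ (#|V| * #|V|) <= _); last first.
  by apply: lerXn2r => //; rewrite nnegrE; lra.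
rewrite exprM -natrX -!natrX ltr_nat ltn_exp2r ?cardV_gt0 //.
exact: leq_ltn_trans k_le_cardV (ltn_expl _ _).
Qed.

Lemma good_iterate c : (forall i, c (t i) = i) ->
  exists2 s, (s < iterations)%N &
    relaxation f (iter s update start)
      <= objective f (parts c) + f setT / (12 * #|V|%:R).
Proof.
move=> ct; have n1 := cardV_ge1.
have [B0|B0] := eqVneq (f setT) 0.
  exists 0%N; first exact: iterations_gt0.
  have := setT_le_objective c; rewrite B0 mul0r addr0; apply: le_trans.
  rewrite /relaxation big1 // => v _; rewrite big1 // => j _.
  suff -> : greedy f (start j) v = 0 by rewrite mulr0.
  apply/eqP; rewrite eq_le greedy_ge0 // andbT -B0; exact: greedy_le.
have {}B0 : 0 < f setT by rewrite lt_neqAle eq_sym B0 -fN fM // sub0set.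
pose good s := relaxation f (iter s update start)
  <= objective f (parts c) + f setT / (12 * #|V|%:R).
have [/existsP[s sgood]|] := boolP [exists s : 'I_iterations, good s].
  by exists s.
rewrite negb_exists => /forallP nogood.
pose d : R := 1 + 1 / (576 * #|V|%:R ^+ 4).
have d0 : 0 <= d by rewrite addr_ge0 // divr_ge0 // mulr_ge0 // exprn_ge0.
have grow s : (s <= iterations)%N ->
    d ^+ s * potential c start <= potential c (iter s update start).
  elim: s => [|s IH] sT; first by rewrite mul1r.
  rewrite exprS -mulrA /=.
  apply: le_trans (potential_update (iter_fractional s) B0 _); last first.
    by rewrite ltNge; exact: nogood (Ordinal sT).
  by rewrite ler_wpM2l // IH // ltnW.
(* If no iterate were good, the potential would grow from at least k^-n to more than 1. *)
exfalso; have := grow _ (leqnn _); apply/negP; rewrite -ltNge.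
have k1 : 1 <= k%:R :> R by rewrite ler1n.
have P0 : 1 / k%:R ^+ #|V| <= potential c start.
  rewrite /potential div1r -exprVn -prodr_const; apply: ler_prod => v _.
  rewrite invr_ge0 ler0n /start; case: ifP => [/existsP[i /eqP <-]|_].
    by rewrite ct eqxx invf_le1 //; lra.
  by rewrite div1r lexx.
have PT : potential c (iter iterations update start) <= 1.
  apply: prodr_ile1 => v _; have F := iter_fractional iterations.
  by rewrite (frac_ge0 F) (frac_le1 _ _ F).
apply: le_lt_trans PT _; apply: lt_le_trans (_ : d ^+ iterations * (1 / k%:R ^+ #|V|) <= _).
  by rewrite mulrA mulr1 ltr_pdivlMr ?mul1r ?growth // exprn_gt0 //; lra.
by rewrite ler_wpM2l // exprn_ge0.
Qed.

(** The threshold is the top coordinate of a terminal, that is 1, so every part other than [i0]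
    keeps at most its terminal. *)
Lemma start_cost m i0 : argmax start m ->
  objective f (parts (rounding start m i0 (start (m (t i0)) (t i0))))
    <= f setT + \sum_(j | j != i0) f [set t j].
Proof.
have sF := start_fractional.
move=> xm; rewrite (argmax_terminal i0 sF xm) (frac_terminal sF) eqxx.
rewrite /objective (bigD1 i0) //=; apply: lerD; first exact/fM/subsetT.
apply: ler_sum => j ji; apply: fM; apply/subsetP => v; rewrite ffunE !inE.
rewrite /rounding; case: ifP => [|_ /eqP ij]; last by rewrite ij eqxx in ji.
move=> + /eqP mv; rewrite mv /start; case: ifP => _.
  by case: eqP => [->|_] //; rewrite lern0.
(* A coordinate 1/k reaches 1 only if k = 1, and then [j] and [i0] coincide. *)
rewrite ler_pdivlMr ?ltr0n // mul1r lern1 => k1.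
by case/eqP: ji; apply: val_inj; move: (ltn_ord j) (ltn_ord i0) k1 => /=; lia.
Qed.

(** The bound holds for every [argmax] labelling, since ties are broken by the program. The index
    [i0] is a terminal of largest singleton value. *)
Lemma approximation c : (forall i, c (t i) = i) ->
  exists s i0, (s < iterations)%N /\
    forall m, let x := iter s update start in argmax x m ->
    exists u, objective f (parts (rounding x m i0 (x (m u) u)))
      <= 4 / 3 * objective f (parts c).
Proof.
move=> ct; have n1 := cardV_ge1.
have [i0 _ i0max] := @arg_maxP _ _ _ (Ordinal k0) xpredT (fun i => f [set t i]) isT.
have n0 : 0 < 3 * #|V|%:R :> R by lra.
case: (lerP (f setT / (3 * #|V|%:R)) (f [set t i0])) => big.
  have [s sT good] := good_iterate ct.
  exists s, i0; split=> // m x xm.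
  have [u u_le] := rounding_ex fN fM fS i0 (iter_fractional s) xm.
  exists u; apply: le_trans u_le _.
  (* The error f(V) / (12 n), multiplied by 4/3, is exactly a third of the lower bound f(V) / (3 n)
     on the slack. *)
  have -> : 4 / 3 * objective f (parts c) = 4 / 3 * (objective f (parts c)
      + f setT / (12 * #|V|%:R)) - f setT / (3 * #|V|%:R) / 3.
    by field; rewrite pnatr_eq0 -lt0n cardV_gt0.
  by rewrite -/x in good; lra.
exists 0%N, i0; split=> [|m x xm]; first exact: iterations_gt0.
exists (t i0); apply: le_trans (start_cost i0 xm) _.
have B := setT_le_objective c.
(* Each singleton costs less than f(V) / (3 n), and there are at most k <= n of them. *)
have : \sum_(j | j != i0) f [set t j] <= f setT / 3.
  have f0 S : 0 <= f S by rewrite -fN fM // sub0set.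
  apply: le_trans (_ : \sum_(j : 'I_k) f setT / (3 * #|V|%:R) <= _).
    apply: le_trans (_ : \sum_(j | j != i0) f setT / (3 * #|V|%:R) <= _).
      by apply: ler_sum => j _; apply: le_trans (i0max j isT) (ltW big).
    rewrite [leRHS](bigID (fun j => j != i0)) /= lerDl sumr_ge0 // => j _.
    by rewrite divr_ge0 // ltW.
  rewrite sumr_const card_ord -[leLHS]mulr_natr mulrAC ler_pdivrMr // -[leRHS]mulrA.
  by rewrite ler_wpM2l // mulrA mulVf ?pnatr_eq0 // mul1r ler_nat k_le_cardV.
lra.
Qed.

Lemma feasible_parts (W : {ffun 'I_k -> {set V}}) : feasible t W ->
  exists2 c, forall i, c (t i) = i & W = parts c.
Proof.
case/and3P => /forallP Wt /forallP Wd /eqP Wc.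
have uniq i j v : v \in W i -> v \in W j -> i = j.
  move=> vi vj; apply/eqP; apply: contraTT (Wd i) => ij.
  apply/forallPn; exists j; rewrite ij /=; apply/negP => /disjointFr/(_ vi).
  by rewrite vj.
pose c v := odflt (Ordinal k0) [pick i | v \in W i].
have cW v : v \in W (c v).
  have : v \in \bigcup_i W i by rewrite Wc inE.
  case/bigcupP => i _ vi; rewrite /c; case: pickP => [j //|/(_ i)].
  by rewrite vi.
exists c => [i|]; first exact: uniq (cW _) (Wt i).
apply/ffunP => j; rewrite ffunE; apply/setP => v; rewrite inE.
by apply/idP/eqP => [|<- //]; exact: uniq (cW v).
Qed.

End Descent.

(** * A language of bounded loops and its compilation *)

Inductive nterm : Type :=
| Cst of nat
| CardV
| NumK
| Terminal of nterm
| NVar of nat & nterm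
| Plus of nterm & nterm.

Inductive rterm : Type :=
| OfNat of nterm
| RVar of nat & nterm
| RPlus of rterm & rterm
| RMinus of rterm & rterm
| RTimes of rterm & rterm
| ROver of rterm & rterm.

Inductive bterm : Type :=
| LeN of nterm & nterm
| LeR of rterm & rterm
| Neg of bterm
| Conj of bterm & bterm.

(** With these bounds alone, termination and a polynomial running time can be read off the
    syntax. *)
Inductive bound : Type := UpToCst of nat | UpToCard | UpToK.

(* Two families of arrays, of naturals and of reals; scalars are the entries of
   index 0. Ask a x b puts into the real scalar a the value of f at the set of
   the elements whose index, as value of x, satisfies b. *)
Inductive prog : Type :=
| Nop
| AssignN of nat & nterm & nterm
| AssignR of nat & nterm & rterm
| Ask of nat & nat & bterm
| Then of prog & prog
| Cond of bterm & prog & prog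
| For of nat & bound & prog.

Section Denotation.
Variables (R : realType) (V : finType) (f : {set V} -> R).
Variables (k : nat) (term : nat -> nat).

Record memory := Memory { nvar : nat -> nat -> nat; rvar : nat -> nat -> R }.

Definition put (T : Type) (g : nat -> nat -> T) a i (w : T) : nat -> nat -> T :=
  fun b j => if (b == a) && (j == i) then w else g b j.

Definition putn m a i w := Memory (put (nvar m) a i w) (rvar m).
Definition putr m a i w := Memory (nvar m) (put (rvar m) a i w).

Fixpoint evaln m e : nat :=
  match e with
  | Cst c => c
  | CardV => #|V|
  | NumK => k
  | Terminal e => term (minn (evaln m e) #|V|.-1)
  | NVar a e => nvar m a (evaln m e)
  | Plus e1 e2 => (evaln m e1 + evaln m e2)%N
  end.

Fixpoint evalr m e : R :=
  match e with
  | OfNat e => (evaln m e)%:R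
  | RVar a e => rvar m a (evaln m e)
  | RPlus e1 e2 => evalr m e1 + evalr m e2
  | RMinus e1 e2 => evalr m e1 - evalr m e2
  | RTimes e1 e2 => evalr m e1 * evalr m e2
  | ROver e1 e2 => evalr m e1 / evalr m e2
  end.

Fixpoint evalb m e : bool :=
  match e with
  | LeN e1 e2 => (evaln m e1 <= evaln m e2)%N
  | LeR e1 e2 => evalr m e1 <= evalr m e2
  | Neg e => ~~ evalb m e
  | Conj e1 e2 => evalb m e1 && evalb m e2
  end.

Definition evalbound b : nat :=
  match b with UpToCst c => c | UpToCard => #|V| | UpToK => k end.

(** [For] and [Ask] leave their counter at its exit value, as the compiled loops do, so that memory
    and store agree exactly. *)
Fixpoint den p m : memory :=
  match p with
  | Nop => m
  | AssignN a i e => putn m a (evaln m i) (evaln m e)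
  | AssignR a i e => putr m a (evaln m i) (evalr m e)
  | Ask a x b =>
      putr (putn m x 0 #|V|) a 0
        (f [set v | evalb (putn m x 0 (enum_rank v)) b])
  | Then p1 p2 => den p2 (den p1 m)
  | Cond b p1 p2 => if evalb m b then den p1 m else den p2 m
  | For x b p =>
      putn (iteri (evalbound b) (fun i m => den p (putn m x 0 i)) m)
        x 0 (evalbound b)
  end.

End Denotation.

Fixpoint nwritten p : seq nat :=
  match p with
  | AssignN a _ _ => [:: a]
  | Ask _ x _ => [:: x]
  | Then p1 p2 | Cond _ p1 p2 => nwritten p1 ++ nwritten p2
  | For x _ p => x :: nwritten p
  | _ => [::]
  end.

Fixpoint rwritten p : seq nat :=
  match p with
  | AssignR a _ _ => [:: a]
  | Ask a _ _ => [:: a]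
  | Then p1 p2 | Cond _ p1 p2 => rwritten p1 ++ rwritten p2
  | For _ _ p => rwritten p
  | _ => [::]
  end.

(** Arrays are interleaved with stride 32: distinct entries have distinct addresses when array
    numbers are below 32. *)
Fixpoint wfn e :=
  match e with
  | Terminal e => wfn e
  | NVar a e => (a < 32)%N && wfn e
  | Plus e1 e2 => wfn e1 && wfn e2
  | _ => true
  end.

Fixpoint wfr e :=
  match e with
  | OfNat e => wfn e
  | RVar a e => (a < 32)%N && wfn e
  | RPlus e1 e2 | RMinus e1 e2 | RTimes e1 e2 | ROver e1 e2 => wfr e1 && wfr e2
  end.

Fixpoint wfb e :=
  match e with
  | LeN e1 e2 => wfn e1 && wfn e2
  | LeR e1 e2 => wfr e1 && wfr e2
  | Neg e => wfb e
  | Conj e1 e2 => wfb e1 && wfb e2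
  end.

Fixpoint wf p :=
  match p with
  | Nop => true
  | AssignN a i e => [&& (a < 32)%N, wfn i & wfn e]
  | AssignR a i e => [&& (a < 32)%N, wfn i & wfr e]
  | Ask a x b => [&& (a < 32)%N, (x < 32)%N & wfb b]
  | Then p1 p2 => wf p1 && wf p2
  | Cond b p1 p2 => [&& wfb b, wf p1 & wf p2]
  | For x _ p => [&& (x < 32)%N, x \notin nwritten p & wf p]
  end.

Section Frame.
Variables (R : realType) (V : finType) (f : {set V} -> R).
Variables (k : nat) (term : nat -> nat).
Local Notation den := (den f k term).

Lemma nvar_den p m a i : a \notin nwritten p -> nvar (den p m) a i = nvar m a i.
Proof.
elim: p m => //= [b j e|b x e|p1 IH1 p2 IH2|e p1 IH1 p2 IH2|x b p IH] m.
- by rewrite inE /put => /negPf ->.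
- by rewrite inE /put => /negPf ->.
- by rewrite mem_cat negb_or => /andP[n1 n2]; rewrite IH2 ?IH1.
- by rewrite mem_cat negb_or => /andP[n1 n2]; case: ifP; rewrite ?IH2 ?IH1.
- rewrite inE negb_or /put => /andP[/negPf ax ap]; rewrite ax /=.
  elim: (evalbound _ _ b) => //= B IHB.
  by rewrite IH //= /put ax.
Qed.

Lemma rvar_den p m a i : a \notin rwritten p -> rvar (den p m) a i = rvar m a i.
Proof.
elim: p m => //= [b j e|b x e|p1 IH1 p2 IH2|e p1 IH1 p2 IH2|x b p IH] m.
- by rewrite inE /put => /negPf ->.
- by rewrite inE /put => /negPf ->.
- by rewrite mem_cat negb_or => /andP[n1 n2]; rewrite IH2 ?IH1.
- by rewrite mem_cat negb_or => /andP[n1 n2]; case: ifP; rewrite ?IH2 ?IH1.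
- by move=> ap; elim: (evalbound _ _ b) => //= B IHB; rewrite IH.
Qed.

End Frame.

(* Array a, entry i lies at address 2 #|V| + 2 + a + 32 i (naturals) or
   a + 32 i (reals); the cells #|V| + 2, ..., 2 #|V| + 1 hold the indicator
   passed to the oracle. *)
Definition times32 (e : nexp) : nexp :=
  let e2 := NAdd e e in let e4 := NAdd e2 e2 in let e8 := NAdd e4 e4 in
  let e16 := NAdd e8 e8 in NAdd e16 e16.

Definition cardv : nexp := NGet (NConst 0).

Definition naddr a (e : nexp) : nexp :=
  NAdd (NAdd cardv cardv) (NAdd (NConst (2 + a)) (times32 e)).

Definition raddr a (e : nexp) : nexp := NAdd (NConst a) (times32 e).

Definition nscalar a : nexp := NGet (naddr a (NConst 0)).

(* The index of a terminal is truncated to #|V| - 1, which keeps the address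
   within the part of the input region that is never overwritten. *)
Fixpoint compilen e : nexp :=
  match e with
  | Cst c => NConst c
  | CardV => cardv
  | NumK => NGet (NConst 1)
  | Terminal e =>
      let e' := compilen e in
      NGet (NAdd (NConst 2) (NSub e' (NSub e' (NSub cardv (NConst 1)))))
  | NVar a e => NGet (naddr a (compilen e))
  | Plus e1 e2 => NAdd (compilen e1) (compilen e2)
  end.

Fixpoint compiler e : rexp :=
  match e with
  | OfNat e => RNat (compilen e)
  | RVar a e => RGet (raddr a (compilen e))
  | RPlus e1 e2 => RAdd (compiler e1) (compiler e2)
  | RMinus e1 e2 => RSub (compiler e1) (compiler e2)
  | RTimes e1 e2 => RMul (compiler e1) (compiler e2)
  | ROver e1 e2 => RDiv (compiler e1) (compiler e2)
  end.

Fixpoint compileb e : bexp :=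
  match e with
  | LeN e1 e2 => NLe (compilen e1) (compilen e2)
  | LeR e1 e2 => RLe (compiler e1) (compiler e2)
  | Neg e => BNot (compileb e)
  | Conj e1 e2 => BAnd (compileb e1) (compileb e2)
  end.

Definition compilebound b : nexp :=
  match b with UpToCst c => NConst c | UpToCard => cardv | UpToK => NGet (NConst 1) end.

Definition count_up x (b : nexp) (c : cmd) : cmd :=
  Seq (NSet (naddr x (NConst 0)) (NConst 0))
    (While (NLe (NAdd (nscalar x) (NConst 1)) b)
       (Seq c (NSet (naddr x (NConst 0)) (NAdd (nscalar x) (NConst 1))))).

Definition indicator_cell x : nexp := NAdd (NAdd cardv (NConst 2)) (nscalar x).

Fixpoint compile p : cmd :=
  match p with
  | Nop => Skip
  | AssignN a i e => NSet (naddr a (compilen i)) (compilen e)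
  | AssignR a i e => RSet (raddr a (compilen i)) (compiler e)
  | Ask a x b =>
      Seq (count_up x cardv (If (compileb b) (NSet (indicator_cell x) (NConst 1))
                                             (NSet (indicator_cell x) (NConst 0))))
          (Query (raddr a (NConst 0)) (NAdd cardv (NConst 2)))
  | Then p1 p2 => Seq (compile p1) (compile p2)
  | Cond b p1 p2 => If (compileb b) (compile p1) (compile p2)
  | For x b p => count_up x (compilebound b) (compile p)
  end.

(** * Timed execution of commands *)

Section Steps.
Variables (R : realType) (V : finType) (f : {set V} -> R).
Implicit Types (s : store R) (c : cmd) (Q : store R -> Prop).

(* Whatever the coins and the remaining commands cs, c terminates within
   `time` steps in a store satisfying Q. *)
Definition steps c s (time : nat) Q : Prop :=
  exists n s', [/\ (n <= time)%N, Q s' &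
    forall cs (l : seq bool), size l = n ->
      foldl (step f) (c :: cs, s) l = (cs, s')].

Lemma steps_weaken c s n n' Q Q' : (n <= n')%N -> (forall s', Q s' -> Q' s') ->
  steps c s n Q -> steps c s n' Q'.
Proof.
move=> nn' QQ' [m [s' [mn Qs' run]]]; exists m, s'; split=> //.
- exact: leq_trans mn nn'.
- exact: QQ'.
Qed.

Lemma steps_one c s s' Q : Q s' ->
  (forall cs b, step f (c :: cs, s) b = (cs, s')) -> steps c s 1 Q.
Proof.
by move=> Qs' st; exists 1%N, s'; split=> // cs [//|b [|//]] _; exact: st.
Qed.

Lemma steps_seq c1 c2 s n1 n2 Q Q' : steps c1 s n1 Q ->
  (forall s', Q s' -> steps c2 s' n2 Q') -> steps (Seq c1 c2) s (n1 + n2).+1 Q'.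
Proof.
move=> [m1 [s1 [mn1 /[swap] run1 /[swap] H]]] /H [m2 [s2 [mn2 Qs2 run2]]].
exists (m1 + m2).+1, s2; split=> // [|cs [//|b l] /= [sl]].
  by rewrite ltnS leq_add.
rewrite -(cat_take_drop m1 l) foldl_cat run1 ?run2 //.
  by rewrite size_drop sl addKn.
by rewrite size_take sl; case: ltnP => //; lia.
Qed.

Lemma steps_if e c1 c2 s n Q :
  (if beval s e then steps c1 s n Q else steps c2 s n Q) ->
  steps (If e c1 c2) s n.+1 Q.
Proof.
case E: (beval s e) => -[m [s' [mn Qs' run]]];
  by exists m.+1, s'; split=> // cs [//|b l] /= [sl]; rewrite E run.
Qed.

Lemma steps_while e c (I : nat -> store R -> Prop) B n s :
  (forall i s', (i <= B)%N -> I i s' -> beval s' e = (i < B)%N) ->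
  (forall i s', (i < B)%N -> I i s' -> steps c s' n (I i.+1)) ->
  I 0%N s -> steps (While e c) s (B * n.+1).+1 (I B).
Proof.
move=> guard body I0.
suff H d i s' : (d + i = B)%N -> I i s' ->
    steps (While e c) s' (d * n.+1).+1 (I B).
  by apply: H I0; rewrite addn0.
elim: d i s' => [|d IH] i s' diB Is.
  rewrite add0n in diB; rewrite diB in Is.
  apply: (steps_one Is) => cs b /=.
  by rewrite (guard B) ?ltnn.
have iB : (i < B)%N by lia.
have [m1 [s1 [mn1 I1 run1]]] := body i s' iB Is.
have [|m2 [s2 [mn2 I2 run2]]] := IH i.+1 s1 _ I1; first by lia.
exists (m1 + m2).+1, s2; split=> // [|cs [//|b l] /= [sl]].
  by rewrite mulSn; lia.
rewrite (guard i) ?(ltnW iB) // iB.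
rewrite -(cat_take_drop m1 l) foldl_cat run1 ?run2 //.
  by rewrite size_drop sl addKn.
by rewrite size_take sl; case: ltnP => //; lia.
Qed.

End Steps.

Lemma neval_times32 (R : realType) (s : store R) e : neval s (times32 e) = (32 * neval s e)%N.
Proof. by rewrite /times32 /=; lia. Qed.

(** * Simulation of programs by commands *)

Section Compilation.
Variables (R : realType) (V : finType) (f : {set V} -> R).
Variables (k : nat) (term : nat -> nat).
Hypothesis V0 : (0 < #|V|)%N.
Local Notation n := #|V|.
Local Notation evaln := (@evaln R V k term).
Local Notation evalr := (@evalr R V k term).
Local Notation evalb := (@evalb R V k term).
Local Notation den := (den f k term).
Implicit Types (s : store R) (m : memory R).

(** The indicator cells are left unconstrained, so oracle queries may overwrite them freely. *)
Record represents s m : Prop := Represents {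
  rep_card : ncell s 0 = n;
  rep_k : ncell s 1 = k;
  rep_terminal : forall i, (i < n)%N -> ncell s (2 + i) = term i;
  rep_nvar : forall a i, (a < 32)%N ->
    ncell s (n + n + (2 + a + 32 * i)) = nvar m a i;
  rep_rvar : forall a i, (a < 32)%N -> rcell s (a + 32 * i) = rvar m a i }.

Lemma eq_represents s m m' : (forall a i, nvar m a i = nvar m' a i) ->
  (forall a i, rvar m a i = rvar m' a i) -> represents s m -> represents s m'.
Proof. by move=> mn mr [*]; split=> // *; rewrite -(mn, mr); auto. Qed.

Lemma represents_putn s m a i w : (a < 32)%N -> represents s m ->
  represents (nset s (n + n + (2 + a + 32 * i)) w) (putn m a i w).
Proof.
move=> a32 [cd ck ct cn cr]; split=> //= [| |j jn|b j b32]; rewrite /upd.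
- by rewrite ifF //; lia.
- by rewrite ifF //; lia.
- by rewrite ifF ?ct //; lia.
rewrite /put; have -> : (n + n + (2 + b + 32 * j) == n + n + (2 + a + 32 * i))%N
    = (b == a) && (j == i).
  by apply/eqP/andP => [h|[/eqP -> /eqP ->] //]; split; apply/eqP; lia.
by rewrite cn.
Qed.

Lemma represents_putr s m a i w : (a < 32)%N -> represents s m ->
  represents (rset s (a + 32 * i) w) (putr m a i w).
Proof.
move=> a32 [cd ck ct cn cr]; split=> //= b j b32; rewrite /upd /put.
have -> : (b + 32 * j == a + 32 * i)%N = (b == a) && (j == i).
  by apply/eqP/andP => [h|[/eqP -> /eqP ->] //]; split; apply/eqP; lia.
by rewrite cr.
Qed.

Lemma represents_indicator s m i w : (i < n)%N -> represents s m ->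
  represents (nset s (n + 2 + i) w) m.
Proof.
move=> ltin [cd ck ct cn cr]; split=> //= [| |j jn|b j b32]; rewrite /upd.
- by rewrite ifF //; lia.
- by rewrite ifF //; lia.
- by rewrite ifF ?ct //; lia.
- by rewrite ifF ?cn //; set N := #|V| in ltin *; lia.
Qed.

Lemma neval_naddr s m a e : represents s m ->
  neval s (naddr a e) = (n + n + (2 + a + 32 * neval s e))%N.
Proof. by case=> cd _ _ _ _; rewrite /naddr -neval_times32 /= cd. Qed.

Lemma neval_nscalar s m x : represents s m -> (x < 32)%N ->
  neval s (nscalar x) = nvar m x 0.
Proof.
move=> rep x32.
by rewrite -(rep_nvar rep) // -(neval_naddr x (NConst 0) rep).
Qed.

Lemma neval_compile s m e : represents s m -> wfn e ->
  neval s (compilen e) = evaln m e.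
Proof.
move=> rep; elim: e => //= [_|_|e IH /IH {}IH|a e IH /andP[a32 /IH {}IH]
  |e1 IH1 e2 IH2 /andP[/IH1 -> /IH2 ->]] //.
- exact: rep_card rep.
- exact: rep_k rep.
- rewrite IH (rep_card rep).
  have -> : (evaln m e - (evaln m e - (n - 1)) = minn (evaln m e) n.-1)%N by lia.
  by apply: (rep_terminal rep); lia.
- by rewrite -[RHS](rep_nvar rep) // -IH -(neval_naddr _ _ rep).
Qed.

Lemma reval_compile s m e : represents s m -> wfr e ->
  reval s (compiler e) = evalr m e.
Proof.
move=> rep; elim: e => //= [e we|a e /andP[a32 we]| | | |];
  try by move=> e1 IH1 e2 IH2 /andP[/IH1 -> /IH2 ->].
- by rewrite (neval_compile rep we).
- by rewrite -(rep_rvar rep) // -(neval_compile rep we) -neval_times32.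
Qed.

Lemma beval_compile s m e : represents s m -> wfb e ->
  beval s (compileb e) = evalb m e.
Proof.
move=> rep; elim: e => //= [e1 e2|e1 e2|e IH /IH -> //|].
- by move=> /andP[w1 w2]; rewrite !(neval_compile rep).
- by move=> /andP[w1 w2]; rewrite !(reval_compile rep).
- by move=> e1 IH1 e2 IH2 /andP[/IH1 -> /IH2 ->].
Qed.

Lemma neval_bound s m b : represents s m ->
  neval s (compilebound b) = evalbound V k b.
Proof. by case=> cd ck _ _ _; case: b => /=. Qed.

Lemma count_up_steps x b c B time (J : nat -> store R -> Prop) s :
  (forall i s', (i <= B)%N -> J i s' ->
    neval s' (nscalar x) = i /\ neval s' b = B) ->
  (forall i s', (i < B)%N -> J i s' ->
    steps f c s' time (fun s'' =>
      J i.+1 (nset s'' (neval s'' (naddr x (NConst 0)))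
                       (neval s'' (nscalar x)).+1))) ->
  J 0%N (nset s (neval s (naddr x (NConst 0))) 0) ->
  steps f (count_up x b c) s (B * (time + 3) + 3) (J B).
Proof.
move=> guard body J0.
pose Q s' := s' = nset s (neval s (naddr x (NConst 0))) 0.
apply: (@steps_weaken _ _ _ _ _ (1 + (B * (time + 1).+2).+1).+1 _ (J B) _) => //.
  by lia.
apply: (@steps_seq _ _ _ _ _ _ 1 _ Q); first exact: steps_one.
move=> _ ->; apply: steps_while J0 => [i s' iB Js'|i s' iB Js'].
  have [xi bB] := guard i s' iB Js'.
  transitivity (neval s' (nscalar x) + 1 <= neval s' b)%N; first by [].
  by rewrite xi bB addn1.
apply: steps_seq (body i s' iB Js') _ => s'' Js''.
apply: steps_one Js'' _ => cs coin /=.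
by rewrite addn1.
Qed.

Fixpoint cost p : nat :=
  match p with
  | Nop | AssignN _ _ _ | AssignR _ _ _ => 1
  | Ask _ _ _ => (n * (2 + 3) + 3 + 1).+1
  | Then p1 p2 => (cost p1 + cost p2).+1
  | Cond _ p1 p2 => (cost p1 + cost p2).+1
  | For _ b p => (evalbound V k b * (cost p + 3) + 3)
  end.

Lemma compile_correct p s m : wf p -> represents s m ->
  steps f (compile p) s (cost p) (fun s' => represents s' (den p m)).
Proof.
elim: p s m => [|a i e|a i e|a x b|p1 IH1 p2 IH2|b p1 IH1 p2 IH2|x b p IH] s m.
- by move=> _ rep; apply: steps_one rep _.
- move=> /and3P[a32 wi we] rep.
  apply: steps_one (represents_putn (evaln m i) (evaln m e) a32 rep) _ => cs coin.
  by rewrite /= (neval_compile rep we) -(neval_compile rep wi) -neval_times32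
     -(rep_card rep).
- move=> /and3P[a32 wi we] rep.
  apply: steps_one (represents_putr (evaln m i) (evalr m e) a32 rep) _ => cs coin.
  by rewrite /= (reval_compile rep we) -(neval_compile rep wi) -neval_times32.
- move=> /and3P[a32 x32 wb] rep.
  (* After [i] passes the counter is [i] and the first [i] indicator cells are correct. *)
  pose J i s' := represents s' (putn m x 0 i) /\
    forall u, (u < i)%N -> (0 < ncell s' (n + 2 + u))%N = evalb (putn m x 0 u) b.
  apply: (@steps_seq _ _ _ _ _ _ _ _ (J n)).
    apply: count_up_steps.
    + move=> i s' _ [rep' _]; rewrite (neval_nscalar rep') // -(rep_card rep').
      by rewrite /= /put !eqxx.
    + move=> i s' ltin [rep' ind]; apply: steps_if.
      rewrite (beval_compile rep' wb).
      have xi : neval s' (nscalar x) = i.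
        by rewrite (neval_nscalar rep') //= /put !eqxx.
      have final c : ((0 < c)%N = evalb (putn m x 0 i) b) ->
        let s'' := nset s' (n + 2 + i) c in
        J i.+1 (nset s'' (neval s'' (naddr x (NConst 0)))
                  (neval s'' (nscalar x)).+1).
        move=> cE s''; have rep'' := represents_indicator c ltin rep'.
        rewrite (neval_naddr _ _ rep'') (neval_nscalar rep'') // muln0.
        rewrite [nvar _ _ _]/= /put !eqxx /=; split.
          have := represents_putn 0 i.+1 x32 rep''; rewrite muln0.
          by apply: eq_represents => // d j /=; rewrite /put; case: ifP => // ->.
        move=> u; rewrite ltnS leq_eqVlt => /orP[/eqP ->|ui] /=.
          by rewrite /upd eqxx ifF //; set N := #|V| in ltin *; lia.
        by rewrite /upd ifF ?ifF ?ind //; set N := #|V| in ltin *; lia.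
      have cell_i cs c coin : step f (NSet (indicator_cell x) (NConst c) :: cs, s') coin
           = (cs, nset s' (n + 2 + i) c).
        by rewrite -[in RHS]xi -(rep_card rep').
      case: ifP => bi.
        by apply: (steps_one (s' := nset s' (n + 2 + i) 1)) => //; exact: final.
      by apply: (steps_one (s' := nset s' (n + 2 + i) 0)) => //; exact: final.
    + split=> //; rewrite (neval_naddr _ _ rep).
      exact: represents_putn.
  move=> s' [rep' ind]; apply: steps_one (represents_putr 0 _ a32 rep') _.
  move=> cs coin; rewrite /= (rep_card rep'); congr (_, rset _ _ (f _)).
  apply/setP => v; rewrite !inE ind //; exact: ltn_ord.
- move=> /andP[w1 w2] rep; apply: steps_seq (IH1 _ _ w1 rep) _ => s' rep'.
  exact: IH2.
- move=> /and3P[wb w1 w2] rep; apply: steps_if; rewrite (beval_compile rep wb).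
  case: ifP => bE.
    apply: steps_weaken (IH1 _ _ w1 rep) => [|s']; first exact: leq_addr.
    by rewrite [den (Cond _ _ _) _]/= bE.
  apply: steps_weaken (IH2 _ _ w2 rep) => [|s']; first exact: leq_addl.
  by rewrite [den (Cond _ _ _) _]/= bE.
- move=> /and3P[x32 xp wp] rep.
  (* The memory after [i] passes; [J] adds the counter, which the body does not write. *)
  pose iterate i := iteri i (fun i m => den p (putn m x 0 i)) m.
  pose J i s' := represents s' (putn (iterate i) x 0 i).
  apply: (@count_up_steps _ _ _ _ _ J).
  + move=> i s' _ rep'; rewrite (neval_bound _ rep') (neval_nscalar rep') //.
    by rewrite /= /put !eqxx.
  + move=> i s' iB rep'; apply: steps_weaken (IH _ _ wp rep') => // s'' rep''.
    rewrite (neval_naddr _ _ rep'') (neval_nscalar rep'') // nvar_den //= muln0.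
    rewrite /put !eqxx; have := represents_putn 0 i.+1 x32 rep''.
    by rewrite muln0.
  + by rewrite (neval_naddr _ _ rep); exact: represents_putn.
Qed.

End Compilation.

(** The value 10 for [Ask] comes from 5 n + 5 <= 10 n; a loop up to n or k raises the degree by
    one. *)
Fixpoint cost_factor p : nat :=
  match p with
  | Nop | AssignN _ _ _ | AssignR _ _ _ => 1
  | Ask _ _ _ => 10
  | Then p1 p2 | Cond _ p1 p2 => (cost_factor p1 + cost_factor p2).+1
  | For _ (UpToCst c) p => (c * (cost_factor p + 3) + 3)
  | For _ _ p => (cost_factor p + 3 + 3)
  end.

Fixpoint cost_degree p : nat :=
  match p with
  | Nop | AssignN _ _ _ | AssignR _ _ _ => 0
  | Ask _ _ _ => 1
  | Then p1 p2 | Cond _ p1 p2 => maxn (cost_degree p1) (cost_degree p2)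
  | For _ (UpToCst _) p => cost_degree p
  | For _ _ p => (cost_degree p).+1
  end.

Lemma cost_polynomial (V : finType) k p : (0 < #|V|)%N -> (k <= #|V|)%N ->
  (cost V k p <= cost_factor p * #|V| ^ cost_degree p)%N.
Proof.
move=> n0 kn; set n := #|V|.
have n1 d : (1 <= n ^ d)%N by rewrite expn_gt0 n0.
have two p1 p2 : (cost V k p1 <= cost_factor p1 * n ^ cost_degree p1)%N ->
    (cost V k p2 <= cost_factor p2 * n ^ cost_degree p2)%N ->
    ((cost V k p1 + cost V k p2).+1 <= (cost_factor p1 + cost_factor p2).+1
      * n ^ maxn (cost_degree p1) (cost_degree p2))%N.
  set d := maxn _ _ => c1 c2; rewrite mulSn mulnDl -addn1 addnC leq_add //.
  apply: leq_add.
    by apply: leq_trans c1 _; rewrite leq_mul2l leq_pexp2l ?leq_maxl ?orbT.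
  by apply: leq_trans c2 _; rewrite leq_mul2l leq_pexp2l ?leq_maxr ?orbT.
elim: p => [|a i e|a i e|a x b|p1 IH1 p2 IH2|b p1 IH1 p2 IH2|x b p IH] //=.
- by rewrite expn1 -/n; lia.
- exact: two.
- exact: two.
have loop B : (B <= n)%N -> (B * (cost V k p + 3) + 3 <=
    (cost_factor p + 3 + 3) * n ^ (cost_degree p).+1)%N.
  move=> Bn; rewrite mulnDl leq_add //; last by rewrite leq_pmulr.
  rewrite expnS mulnCA leq_mul // mulnDl leq_add // leq_pmulr //.
case: b => [c| |] /=; [|exact: loop|exact: loop].
rewrite mulnDl leq_add ?leq_pmulr // -mulnA leq_mul // mulnDl leq_add //.
by rewrite leq_pmulr.
Qed.

(** * The algorithm *)

Notation OFFSET := 0%N (only parsing).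
Notation MODE := 1%N (only parsing).
Notation PART := 2%N (only parsing).
Notation BEST := 3%N (only parsing).
Notation vJ := 4%N (only parsing).
Notation vU := 5%N (only parsing).
Notation vI := 6%N (only parsing).
Notation vT := 7%N (only parsing).
Notation vA := 8%N (only parsing).
Notation rX := 0%N (only parsing).
Notation rW := 1%N (only parsing).
Notation rTOP := 2%N (only parsing).
Notation rAVG := 3%N (only parsing).
Notation rCOST := 4%N (only parsing).
Notation rBESTCOST := 5%N (only parsing).
Notation rFULL := 6%N (only parsing).
Notation rDENOM := 7%N (only parsing).
Notation rHEAD := 8%N (only parsing).
Notation rTAIL := 9%N (only parsing).

Notation nscal a := (NVar a (Cst 0)).
Notation rscal a := (RVar a (Cst 0)).
Notation setr a e := (AssignR a (Cst 0) e).

(* Entry (j, v) of a k by #|V| matrix; OFFSET tabulates j * #|V|. *)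
Notation entry a j v := (RVar a (Plus (NVar OFFSET j) v)).
Notation set_entry a j v e := (AssignR a (Plus (NVar OFFSET j) v) e).

Definition eqn_term e1 e2 := Conj (LeN e1 e2) (LeN e2 e1).

(** The order [before] of [vA] and [vU] for row [vJ], expressed with [<=], negation and conjunction
    only. *)
Definition before_term : bterm :=
  let xa := entry rX (nscal vJ) (nscal vA) in
  let xu := entry rX (nscal vJ) (nscal vU) in
  Conj (LeR xu xa) (Neg (Conj (LeR xa xu) (Neg (LeN (nscal vA) (nscal vU))))).

(** Naturals have no product, so the multiples of [#|V|] are tabulated by repeated addition from the
    initial 0. *)
Definition offsets_prog :=
  For vJ UpToK (AssignN OFFSET (Plus (nscal vJ) (Cst 1))
                 (Plus (NVar OFFSET (nscal vJ)) CardV)).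

Definition uniform_prog :=
  For vJ UpToK (For vU UpToCard
    (set_entry rX (nscal vJ) (nscal vU) (ROver (OfNat (Cst 1)) (OfNat NumK)))).

Definition terminals_prog :=
  For vI UpToK (For vJ UpToK
    (Cond (eqn_term (nscal vJ) (nscal vI))
       (set_entry rX (nscal vJ) (Terminal (nscal vI)) (OfNat (Cst 1)))
       (set_entry rX (nscal vJ) (Terminal (nscal vI)) (OfNat (Cst 0))))).

(** By monotonicity k f(V) bounds the cost of every partition, so it serves as the initial best
    cost. *)
Definition constants_prog :=
  Then (Ask rFULL vA (LeN (Cst 0) (Cst 0)))
  (Then (setr rBESTCOST (RTimes (OfNat NumK) (rscal rFULL)))
        (setr rDENOM (RTimes (RTimes (RTimes (RTimes (OfNat (Cst 24))
           (OfNat CardV)) (OfNat CardV)) (OfNat CardV)) (rscal rFULL)))).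

Definition initialize :=
  Then offsets_prog (Then uniform_prog (Then terminals_prog constants_prog)).

Definition greedy_prog :=
  For vJ UpToK (For vU UpToCard
    (Then (Ask rHEAD vA before_term)
    (Then (Ask rTAIL vA (Conj before_term (Neg (eqn_term (nscal vA) (nscal vU)))))
          (set_entry rW (nscal vJ) (nscal vU) (RMinus (rscal rHEAD) (rscal rTAIL)))))).

Definition argmax_prog :=
  For vU UpToCard
    (Then (AssignN MODE (nscal vU) (Cst 0))
    (Then (For vJ UpToK
             (Cond (LeR (entry rX (NVar MODE (nscal vU)) (nscal vU))
                        (entry rX (nscal vJ) (nscal vU)))
                (AssignN MODE (nscal vU) (nscal vJ))
                Nop))
          (AssignR rTOP (nscal vU) (entry rX (NVar MODE (nscal vU)) (nscal vU))))).

Definition rounding_prog :=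
  For vU UpToCard
    (Cond (LeR (RVar rTOP (nscal vT)) (RVar rTOP (nscal vU)))
       (AssignN PART (nscal vU) (NVar MODE (nscal vU)))
       (AssignN PART (nscal vU) (nscal vI))).

Definition cost_prog :=
  Then (setr rCOST (OfNat (Cst 0)))
    (For vJ UpToK
       (Then (Ask rHEAD vA (eqn_term (NVar PART (nscal vA)) (nscal vJ)))
             (setr rCOST (RPlus (rscal rCOST) (rscal rHEAD))))).

(** The comparison is not strict: the first candidate is recorded even if it costs exactly k
    f(V). *)
Definition record_prog :=
  Cond (LeR (rscal rCOST) (rscal rBESTCOST))
    (Then (setr rBESTCOST (rscal rCOST))
          (For vU UpToCard (AssignN BEST (nscal vU) (NVar PART (nscal vU)))))
    Nop.

Definition search_prog :=
  For vI UpToK (For vT UpToCard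
    (Then rounding_prog (Then cost_prog record_prog))).

Definition update_prog :=
  For vU UpToCard
    (Then (setr rAVG (OfNat (Cst 0)))
    (Then (For vJ UpToK
             (setr rAVG (RPlus (rscal rAVG)
                (RTimes (entry rX (nscal vJ) (nscal vU)) (entry rW (nscal vJ) (nscal vU))))))
          (For vJ UpToK
             (set_entry rX (nscal vJ) (nscal vU)
                (RTimes (entry rX (nscal vJ) (nscal vU))
                   (RPlus (OfNat (Cst 1))
                      (ROver (RMinus (rscal rAVG) (entry rW (nscal vJ) (nscal vU)))
                             (rscal rDENOM)))))))).

Definition round_prog :=
  Then greedy_prog (Then argmax_prog (Then search_prog update_prog)).

(** The nested loops make 576 n^6 rounds without any product of naturals; their counters are not
    written by [round_prog]. *)
Definition main_prog :=
  Then initialize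
    (For 10 (UpToCst 576) (For 11 UpToCard (For 12 UpToCard (For 13 UpToCard
      (For 14 UpToCard (For 15 UpToCard (For 16 UpToCard round_prog))))))).

(* Copies BEST to the output cells in decreasing order: cell 0, on which the
   addresses of all variables depend, is overwritten last. *)
Definition output_cmd : cmd :=
  let z := naddr 17 (NConst 0) in
  Seq (NSet z (NSub cardv (NConst 1)))
  (Seq (While (NLe (NConst 1) (NGet z))
          (Seq (NSet (NGet z) (NGet (naddr BEST (NGet z))))
               (NSet z (NSub (NGet z) (NConst 1)))))
       (NSet (NConst 0) (NGet (naddr BEST (NConst 0))))).

Definition algorithm : cmd := Seq (compile main_prog) output_cmd.

(** * Functional correctness of the algorithm *)

Section Verification.
Variables (R : realType) (V : finType) (f : {set V} -> R).
Hypothesis fN : normalized_setfun f.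
Hypothesis fM : monotone_setfun f.
Hypothesis fS : submodular_setfun f.
Variables (k : nat) (t : 'I_k -> V).
Hypothesis k0 : (0 < k)%N.
Hypothesis tI : injective t.
Variable term : nat -> nat.
Hypothesis termE : forall i : 'I_k, term i = enum_rank (t i).
Local Notation n := #|V|.
Local Notation den := (den f k term).
Local Notation evaln := (@evaln R V k term).
Local Notation evalr := (@evalr R V k term).
Local Notation evalb := (@evalb R V k term).
Implicit Types (m : memory R) (x : 'I_k -> V -> R) (v u : V) (i j : 'I_k).
Implicit Types (p : V -> 'I_k).

Local Notation rank v := (nat_of_ord (enum_rank v)).

Definition same_but (q : prog) m0 m :=
  (forall a l : nat, a \notin nwritten q -> nvar m a l = nvar m0 a l) /\
  (forall a l : nat, a \notin rwritten q -> rvar m a l = rvar m0 a l).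

(** Loop rule for assertions that ignore the counter; the body may also assume that everything the
    loop does not write is as in [m0]. *)
Lemma den_for (P : nat -> memory R -> Prop) z b q m0 :
  P 0%N m0 ->
  (forall l m w, P l m -> P l (putn m z 0 w)) ->
  (forall l m, (l < evalbound V k b)%N -> same_but (For z b q) m0 m ->
     nvar m z 0 = l -> P l m -> P l.+1 (den q m)) ->
  P (evalbound V k b) (den (For z b q) m0).
Proof.
move=> P0 Px body /=; apply: (Px); set B := evalbound V k b.
pose it l := iteri l (fun l m => den q (putn m z 0 l)) m0.
suff H l : (l <= B)%N -> P l (it l) /\ same_but (For z b q) m0 (it l).
  by have [] := H B (leqnn _).
elim: l => [|l IH] lB //.
have [Pl [sn sr]] := IH (ltnW lB); split.
  apply: body => //=; last 1 first.
  - exact: Px.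
  - split=> a i aq /=; last exact: sr.
    have := sn a i aq; move: aq; rewrite /= inE negb_or /put => /andP[/negPf -> _].
    by [].
  - by rewrite /put !eqxx.
split=> a i aq /=; last by rewrite rvar_den //; exact: sr.
have := sn a i aq; move: aq; rewrite /= inE negb_or => /andP[/negPf ax aq] <-.
by rewrite nvar_den //= /put ax.
Qed.

Lemma entry_eq j v j' v' :
  (j' * n + rank v' == j * n + rank v)%N = (j' == j) && (v' == v).
Proof.
apply/eqP/andP => [h|[/eqP -> /eqP -> //]].
have n0 : (0 < n)%N by apply: leq_ltn_trans (ltn_ord (enum_rank v)).
have jj : j' = j :> nat.
  by have := congr1 (divn^~ n) h; rewrite !divnMDl // !divn_small // !addn0.
by move: h; rewrite jj => /addnI/val_inj/enum_rank_inj ->; split; apply/eqP => //;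
  exact: val_inj.
Qed.

Lemma rankP (l : nat) : (l < n)%N -> exists v, rank v = l.
Proof. by move=> ln; exists (enum_val (Ordinal ln)); rewrite enum_valK. Qed.

Lemma rank_lt v : (rank v < n)%N. Proof. exact: ltn_ord. Qed.

Lemma rank_eq u v : (rank u == rank v) = (u == v).
Proof. by rewrite val_eqE (inj_eq enum_rank_inj). Qed.

Definition offsets m := forall l, (l < k)%N -> nvar m OFFSET l = (l * n)%N.

Definition matrix_at a m x := forall j v, rvar m a (j * n + rank v) = x j v.

Definition vector_at a m (y : V -> R) := forall v, rvar m a (rank v) = y v.

Definition labels_at a m p := forall v, nvar m a (rank v) = p v.

Lemma offsets_spec m : (forall l, nvar m OFFSET l = 0%N) ->
  offsets (den offsets_prog m).
Proof.
move=> m0.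
pose P l m := forall l', (l' <= l)%N -> nvar m OFFSET l' = (l' * n)%N.
suff : P k (den offsets_prog m) by move=> H l lk; exact: H (ltnW lk).
apply: (@den_for P vJ UpToK) => //= [l'|l m' lk _ mJ Pl l'].
  by rewrite leqn0 m0 => /eqP ->.
rewrite /= /put mJ addn1 /=; case: eqP => [-> _|l'l].
  by rewrite Pl // mulSn addnC.
by rewrite leq_eqVlt => /orP[/eqP //|]; exact: Pl.
Qed.

(** Loop rule for independent passes: each one establishes [Q] at its own element and preserves it
    at the others. *)
Lemma for_each_element (Inv : memory R -> Prop) (Q : V -> memory R -> Prop)
    z q m0 :
  Inv m0 -> (forall m w, Inv m -> Inv (putn m z 0 w)) ->
  (forall v m w, Q v m -> Q v (putn m z 0 w)) ->
  (forall v m, same_but (For z UpToCard q) m0 m -> nvar m z 0 = rank v ->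
     Inv m -> [/\ Inv (den q m), Q v (den q m) &
       forall u, u != v -> Q u m -> Q u (den q m)]) ->
  Inv (den (For z UpToCard q) m0) /\
  forall v, Q v (den (For z UpToCard q) m0).
Proof.
move=> I0 Iz Qz body.
pose P l m := Inv m /\ forall v, (rank v < l)%N -> Q v m.
suff [II QQ] : P n (den (For z UpToCard q) m0).
  by split=> // v; apply: QQ; exact: rank_lt.
apply: (@den_for P z UpToCard) => [//|l m w [Im Qm]|l m ln sm ml [Im Qm]].
  by split=> [|v vl]; [exact: Iz|apply: Qz; exact: Qm].
have [v vl] := rankP ln; rewrite -vl in ml.
have [I' Qv Qu] := body v m sm ml Im; split=> // u; rewrite ltnS leq_eqVlt -vl.
rewrite rank_eq; case: (eqVneq u v) => [-> //|uv /= ul].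
by apply: Qu => //; apply: Qm; rewrite -vl.
Qed.

Lemma for_each_part (Inv : memory R -> Prop) (Q : 'I_k -> memory R -> Prop)
    z q m0 :
  Inv m0 -> (forall m w, Inv m -> Inv (putn m z 0 w)) ->
  (forall j m w, Q j m -> Q j (putn m z 0 w)) ->
  (forall j m, same_but (For z UpToK q) m0 m -> nvar m z 0 = j ->
     Inv m -> [/\ Inv (den q m), Q j (den q m) &
       forall i, i != j -> Q i m -> Q i (den q m)]) ->
  Inv (den (For z UpToK q) m0) /\ forall j, Q j (den (For z UpToK q) m0).
Proof.
move=> I0 Iz Qz body.
pose P l m := Inv m /\ forall j, (j < l)%N -> Q j m.
suff [II QQ] : P k (den (For z UpToK q) m0) by split=> // j; exact: QQ.
apply: (@den_for P z UpToK) => [//|l m w [Im Qm]|l m lk sm ml [Im Qm]].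
  by split=> [|v vl]; [exact: Iz|apply: Qz; exact: Qm].
have [I' Qv Qu] := body (Ordinal lk) m sm ml Im; split=> // i.
rewrite ltnS leq_eqVlt => /orP[/eqP il|il].
  by have -> : i = Ordinal lk by exact: val_inj.
by apply: Qu; [rewrite -val_eqE /= neq_ltn il|exact: Qm].
Qed.

Lemma matrix_loop a (q : prog) m0 (g : 'I_k -> V -> R) :
  (forall j v m, same_but (For vJ UpToK (For vU UpToCard q)) m0 m ->
     nvar m vJ 0 = j -> nvar m vU 0 = rank v ->
     forall i u, rvar (den q m) a (i * n + rank u) =
       if (i == j) && (u == v) then g j v else rvar m a (i * n + rank u)) ->
  vJ \notin nwritten q ->
  matrix_at a (den (For vJ UpToK (For vU UpToCard q)) m0) g.
Proof.
move=> body Jq.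
pose Q j m := forall v, rvar m a (j * n + rank v) = g j v.
have [] // := @for_each_part (fun=> True) Q vJ (For vU UpToCard q) m0.
move=> j m1 [sn1 sr1] m1J _.
pose Inv m := forall i v, i != j -> rvar m a (i * n + rank v) = rvar m1 a (i * n + rank v).
pose Q' v m := rvar m a (j * n + rank v) = g j v.
have [|//|//|v m2 [sn2 sr2] m2U Inv2|] :=
    @for_each_element Inv Q' vU q m1.
- by [].
- have H : forall i u, rvar (den q m2) a (i * n + rank u) =
       if (i == j) && (u == v) then g j v else rvar m2 a (i * n + rank u).
    apply: body => //; last by rewrite sn2.
    by split=> b l bq; [rewrite sn2 ?sn1|rewrite sr2 ?sr1] => //;
       move: bq; rewrite /= !inE !negb_or => /andP[].
  split=> [i u ij||u uv]; rewrite ?/Q' H.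
  + by rewrite (negPf ij) /= Inv2.
  + by rewrite !eqxx.
  + by rewrite eqxx (negPf uv).
- by move=> I' Q2; split=> // i ij Qi v; rewrite I'.
Qed.

Lemma uniform_spec m : offsets m ->
  matrix_at rX (den uniform_prog m) (fun _ _ => 1 / k%:R).
Proof.
move=> mO; apply: matrix_loop => // j v m1 [sn1 _] m1J m1U i u.
by rewrite /= /put /= m1U m1J sn1 // mO // entry_eq.
Qed.

Lemma evalb_eqn m e1 e2 :
  evalb m (eqn_term e1 e2) = (evaln m e1 == evaln m e2).
Proof. by rewrite /= eqn_leq. Qed.

Lemma den_cond b q1 q2 m :
  den (Cond b q1 q2) m = if evalb m b then den q1 m else den q2 m.
Proof. by []. Qed.

Lemma den_then q1 q2 m : den (Then q1 q2) m = den q2 (den q1 m).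
Proof. by []. Qed.

Lemma term_part i : term (minn i n.-1) = rank (t i).
Proof.
have kn := k_le_cardV tI; have ik := ltn_ord i.
by rewrite -termE; congr term; lia.
Qed.

Lemma terminals_spec m : offsets m ->
  matrix_at rX m (fun _ _ => 1 / k%:R) ->
  matrix_at rX (den terminals_prog m) (start R t).
Proof.
move=> mO mX.
pose Inv m := forall j v, ~~ [exists i, t i == v] ->
  rvar m rX (j * n + rank v) = 1 / k%:R.
pose Q i m := forall j, rvar m rX (j * n + rank (t i)) = (j == i)%:R.
have [|//|//|i m1 [sn1 _] m1I Inv1|I' Q'] :=
    @for_each_part Inv Q vI (For vJ UpToK
      (Cond (eqn_term (nscal vJ) (nscal vI))
       (set_entry rX (nscal vJ) (Terminal (nscal vI)) (OfNat (Cst 1)))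
       (set_entry rX (nscal vJ) (Terminal (nscal vI)) (OfNat (Cst 0))))) m.
- by move=> j v _; exact: mX.
- set body := Cond _ _ _.
  pose Inv' m := forall j v, v != t i ->
    rvar m rX (j * n + rank v) = rvar m1 rX (j * n + rank v).
  pose R' j m := rvar m rX (j * n + rank (t i)) = (j == i)%:R.
  have H j m2 : same_but (For vJ UpToK body) m1 m2 -> nvar m2 vJ 0 = j ->
      forall (l : 'I_k) v, rvar (den body m2) rX (l * n + rank v) =
      if (l == j) && (v == t i) then (j == i)%:R else rvar m2 rX (l * n + rank v).
    move=> [sn2 _] m2J l v; rewrite den_cond evalb_eqn /=.
    rewrite m2J sn2 // m1I val_eqE; case: eqP => _;
      by rewrite /= /put /= ?m2J !sn2 // ?m1I sn1 // mO // term_part entry_eq.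
  have [//|//|//|j m2 sm2 m2J Inv2|I2 Q2] := @for_each_part Inv' R' vJ body m1.
    split=> [l v vi||l lj Rl]; rewrite ?/R' (H j) //.
    + by rewrite (negPf vi) andbF Inv2.
    + by rewrite !eqxx.
    + by rewrite (negPf lj).
  split=> // [j v vt|l li Ql j]; rewrite I2 //.
  + by rewrite Inv1.
  + by apply: contraNneq vt => ->; apply/existsP; exists i.
  + by rewrite (inj_eq tI).
- move=> j v; rewrite /start; case: ifPn => [/existsP[i /eqP <-]|/I' //].
  by rewrite Q' (inj_eq tI).
Qed.

Record constants m : Prop := Constants {
  constants_offsets : offsets m;
  constants_full : rvar m rFULL 0 = f setT;
  constants_denom : rvar m rDENOM 0 = step_denominator f }.

Lemma evalb_before m x j v u : offsets m -> matrix_at rX m x ->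
  nvar m vJ 0 = j -> nvar m vU 0 = rank v -> nvar m vA 0 = rank u ->
  evalb m before_term = before (x j) u v.
Proof.
move=> mO mX mJ mU mA; rewrite /= mJ mU mA mO // !mX /before.
by case: (ltgtP (x j v) (x j u)) => //=; rewrite negbK.
Qed.

Lemma greedy_spec m x : constants m -> matrix_at rX m x ->
  matrix_at rW (den greedy_prog m) (fun j => greedy f (x j)).
Proof.
move=> [mO _ _] mX; apply: matrix_loop => // j v m1 [sn1 sr1] m1J m1U i u.
have m1O : offsets m1 by move=> l lk; rewrite sn1 ?mO.
have m1X : matrix_at rX m1 x by move=> l w; rewrite sr1.
have E (m2 : memory R) w :
    (forall a l, a != vA -> nvar m2 a l = nvar m1 a l) ->
    (forall l, rvar m2 rX l = rvar m1 rX l) ->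
    evalb (putn m2 vA 0 (rank w)) before_term = before (x j) w v.
  move=> m2n m2r; apply: evalb_before => //.
  - by move=> l lk; rewrite /= /put /= m2n // m1O.
  - by move=> l w'; rewrite /= m2r m1X.
  - by rewrite /= /put /= m2n.
  - by rewrite /= /put /= m2n.
pose m2 := den (Ask rHEAD vA before_term) m1.
have tailE : [set w | evalb (putn m2 vA 0 (rank w))
    (Conj before_term (Neg (eqn_term (nscal vA) (nscal vU))))] = prefix (x j) v :\ v.
  apply/setP => w; rewrite !inE.
  rewrite -[evalb _ _]/(evalb _ before_term && ~~ evalb _ (eqn_term _ _)).
  rewrite evalb_eqn E; first by rewrite /= /put /= m1U rank_eq andbC.
  - by move=> a l /negPf aA; rewrite /= /put aA.
  - by [].
rewrite !den_then -/m2 [den (Ask _ _ _) m2]/= -/(evalb _ _) tailE.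
rewrite /= /put /= m1J m1U m1O // entry_eq; case: ifP => // _.
congr (f _ - _); apply/setP => w; rewrite !inE !m1X /before.
by case: (ltgtP (x j v) (x j w)) => //=; rewrite negbK.
Qed.

Lemma argmax_spec m x : constants m -> matrix_at rX m x ->
  exists2 p, argmax x p & labels_at MODE (den argmax_prog m) p /\
    vector_at rTOP (den argmax_prog m) (fun v => x (p v) v).
Proof.
move=> [mO _ _] mX.
pose Q v m := exists2 q : 'I_k, forall j, x j v <= x q v &
  nvar m MODE (rank v) = q /\ rvar m rTOP (rank v) = x q v.
have [//|//|//|v m1 [sn1 sr1] m1U _|_ H] := @for_each_element (fun=> True) Q vU
   (Then (AssignN MODE (nscal vU) (Cst 0))
    (Then (For vJ UpToK
             (Cond (LeR (entry rX (NVar MODE (nscal vU)) (nscal vU))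
                        (entry rX (nscal vJ) (nscal vU)))
                (AssignN MODE (nscal vU) (nscal vJ))
                Nop))
          (AssignR rTOP (nscal vU) (entry rX (NVar MODE (nscal vU)) (nscal vU))))) m.
  rewrite !den_then; set m2 := den _ m1.
  set m3 := den _ m2.
  have m2U : nvar m2 vU 0 = rank v by rewrite /m2 /= m1U.
  have m2m : nvar m2 MODE (rank v) = 0%N by rewrite /m2 /= /put /= m1U eqxx.
  have m2O : offsets m2 by move=> l lk; rewrite /m2 /= /put /= sn1 // mO.
  have m2X : matrix_at rX m2 x by move=> j w; rewrite /m2 /= /put /= sr1.
  (* Running maximum over the first [l] parts; the label 0 written beforehand stands for
     [Ordinal k0]. *)
  pose P l m := (exists2 q : 'I_k, nvar m MODE (rank v) = q &
      forall j, (j < l)%N -> x j v <= x q v) /\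
    forall u, u != v -> nvar m MODE (rank u) = nvar m2 MODE (rank u).
  have [[q m3q qmax] m3m] : P k m3.
    apply: (@den_for P vJ UpToK) => [|//|l m4 lk [sn4 sr4] m4J [[q m4q qmax] m4m]].
      by split=> //; exists (Ordinal k0).
    have m4U : nvar m4 vU 0 = rank v by rewrite sn4.
    have m4O : offsets m4 by move=> l' lk'; rewrite sn4 // m2O.
    have m4X : matrix_at rX m4 x by move=> j w; rewrite sr4.
    rewrite /P /= m4U m4q m4J !m4O // -[l]/(nat_of_ord (Ordinal lk)) !m4X.
    case: leP => xq; split=> //=.
    - exists (Ordinal lk); first by rewrite /put /= ?m4U ?m4J eqxx.
      move=> j; rewrite ltnS leq_eqVlt => /orP[/eqP jl|/qmax jq].
        by have -> : j = Ordinal lk by exact: val_inj.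
      exact: le_trans jq xq.
    - by move=> u uv; rewrite /put /= ?m4U rank_eq (negPf uv) m4m.
    - exists q => // j; rewrite ltnS leq_eqVlt => /orP[/eqP jl|/qmax //].
      have -> : j = Ordinal lk by exact: val_inj.
      exact: ltW.
  have m3U : nvar m3 vU 0 = rank v by rewrite nvar_den.
  have m3O : offsets m3 by move=> l lk; rewrite nvar_den // m2O.
  have m3X : matrix_at rX m3 x by move=> j w; rewrite rvar_den.
  have m3T l : rvar m3 rTOP l = rvar m1 rTOP l by rewrite rvar_den.
  clearbody m3.
  split=> //.
    exists q; first by move=> j; exact: qmax.
    by rewrite /= /put /= m3U eqxx m3q m3O // m3X.
  move=> u uv [r rmax [mr tr]]; exists r => //; split.
    by rewrite /= m3m // /m2 /= /put /= m1U rank_eq (negPf uv).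
  by rewrite /= /put /= m3U rank_eq (negPf uv) m3T.
(* The witnesses obtained for each element become a function by reading the labels off the
   memory. *)
pose p v := odflt (Ordinal k0) [pick q : 'I_k | nvar (den argmax_prog m) MODE (rank v) == q].
have pE v : Q v (den argmax_prog m) ->
    [/\ forall j, x j v <= x (p v) v, nvar (den argmax_prog m) MODE (rank v) = p v
      & rvar (den argmax_prog m) rTOP (rank v) = x (p v) v].
  case=> q qmax [mq tq]; suff -> : p v = q by [].
  rewrite /p mq; case: pickP => [q' /eqP/val_inj //|/(_ q)].
  by rewrite eqxx.
by exists p; [|split] => v; case: (pE v (H v)).
Qed.

Lemma rounding_spec m x p i0 u0 : labels_at MODE m p ->
  vector_at rTOP m (fun v => x (p v) v) ->
  nvar m vI 0 = i0 -> nvar m vT 0 = rank u0 ->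
  labels_at PART (den rounding_prog m) (rounding x p i0 (x (p u0) u0)).
Proof.
move=> mM mT mI mT0.
pose Q v m := nvar m PART (rank v) = rounding x p i0 (x (p u0) u0) v.
have [//|//|//|v m1 [sn1 sr1] m1U _|_ H v] := @for_each_element (fun=> True) Q vU
   (Cond (LeR (RVar rTOP (nscal vT)) (RVar rTOP (nscal vU)))
       (AssignN PART (nscal vU) (NVar MODE (nscal vU)))
       (AssignN PART (nscal vU) (nscal vI))) m; last exact: H.
rewrite den_cond /= m1U !sr1 // !sn1 // mT0 !mT mI.
split=> // [|u uv Qu].
  rewrite /Q /rounding.
  by case: ifP => _; rewrite /= /put /= eqxx ?mM.
by case: ifP => _; rewrite /Q /= /put /= rank_eq (negPf uv).
Qed.

Lemma cost_spec m p : labels_at PART m p ->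
  rvar (den cost_prog m) rCOST 0 = objective f (parts p).
Proof.
move=> mP; rewrite den_then; set m1 := den _ m.
pose P l m := rvar m rCOST 0 = \sum_(j < k | (j < l)%N) f (parts p j).
suff : P k (den (For vJ UpToK
       (Then (Ask rHEAD vA (eqn_term (NVar PART (nscal vA)) (nscal vJ)))
             (setr rCOST (RPlus (rscal rCOST) (rscal rHEAD))))) m1).
  by rewrite /P => ->; apply: eq_bigl => j; rewrite ltn_ord.
apply: (@den_for P vJ UpToK) => [|//|l m2 lk [sn2 _] m2J P2].
  by rewrite /P /m1 /= /put /= big_pred0.
rewrite /P (bigD1 (Ordinal lk)) //= /put /= addrC; congr (_ + f _).
  rewrite P2; apply: eq_bigl => j; rewrite -val_eqE /= ltnS.
  by rewrite [RHS]andbC ltn_neqAle.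
apply/setP => v; rewrite ffunE !inE -eqn_leq m2J sn2 // /m1 /=.
by rewrite (mP v) -val_eqE.
Qed.

Definition recorded m := exists p, [/\ labels_at BEST m p,
  forall i, p (t i) = i & rvar m rBESTCOST 0 = objective f (parts p)].

(** If nothing has been recorded, the best cost is still k f(V), which no partition exceeds, so the
    candidate is accepted. *)
Lemma record_spec m p : labels_at PART m p -> (forall i, p (t i) = i) ->
  rvar m rCOST 0 = objective f (parts p) ->
  rvar m rBESTCOST 0 = k%:R * f setT \/ recorded m ->
  [/\ recorded (den record_prog m),
    rvar (den record_prog m) rBESTCOST 0 <= rvar m rBESTCOST 0 &
    rvar (den record_prog m) rBESTCOST 0 <= objective f (parts p)].
Proof.
move=> mP pt mC best; rewrite den_cond.
have -> : evalb m (LeR (rscal rCOST) (rscal rBESTCOST)) =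
  (objective f (parts p) <= rvar m rBESTCOST 0) by rewrite /= mC.
case: leP => [le_best|gt_best].
  rewrite den_then; set m1 := den _ m.
  have m1B : rvar m1 rBESTCOST 0 = objective f (parts p).
    by rewrite /m1 /= /put /= mC.
  pose Q v m := nvar m BEST (rank v) = p v.
  have [//|//|//|v m2 [sn2 _] m2U _|_ H] := @for_each_element (fun=> True) Q vU
    (AssignN BEST (nscal vU) (NVar PART (nscal vU))) m1.
    split=> // [|u uv]; rewrite /Q /= /put /= m2U ?eqxx.
      by rewrite sn2 // (mP v).
    by rewrite rank_eq (negPf uv).
  by split; [exists p; split=> //|..]; rewrite rvar_den // m1B.
split=> //; last exact: ltW.
case: best => // best; exfalso; move: gt_best; rewrite best ltNge.
rewrite /objective mulr_natl -[X in _ *+ X]card_ord -sumr_const.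
by rewrite ler_sum // => j _; exact/fM/subsetT.
Qed.

Lemma search_body_spec m x p i0 u0 : fractional t x -> argmax x p ->
  labels_at MODE m p -> vector_at rTOP m (fun v => x (p v) v) ->
  nvar m vI 0 = i0 -> nvar m vT 0 = rank u0 ->
  rvar m rBESTCOST 0 = k%:R * f setT \/ recorded m ->
  let m' := den (Then rounding_prog (Then cost_prog record_prog)) m in
  [/\ recorded m', rvar m' rBESTCOST 0 <= rvar m rBESTCOST 0 &
    rvar m' rBESTCOST 0 <=
      objective f (parts (rounding x p i0 (x (p u0) u0)))].
Proof.
move=> xF px mM mT mI mT0 best; rewrite !den_then.
have labels1 := rounding_spec mM mT mI mT0.
set p' := rounding _ _ _ _ in labels1 *; set m1 := den _ m in labels1 *.
have cost2 := cost_spec labels1; set m2 := den _ m1 in cost2 *.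
have m2B : rvar m2 rBESTCOST 0 = rvar m rBESTCOST 0 by rewrite !rvar_den.
rewrite -m2B; apply: record_spec => //.
- by move=> v; rewrite nvar_den // labels1.
(* A terminal has top coordinate 1, which reaches every threshold taken from [x], so it stays in its
   own part. *)
- move=> i; rewrite /p' /rounding (argmax_terminal i xF px).
  by rewrite (frac_terminal xF) eqxx (frac_le1 _ _ xF).
- rewrite m2B; case: best => [|[q [lq qt bq]]]; [by left|right].
  exists q; split=> //; last by rewrite m2B.
  by move=> v; rewrite !nvar_den // lq.
Qed.

Lemma search_spec m x p : fractional t x -> argmax x p ->
  labels_at MODE m p -> vector_at rTOP m (fun v => x (p v) v) ->
  rvar m rBESTCOST 0 = k%:R * f setT \/ recorded m ->
  let m' := den search_prog m in
  [/\ recorded m', rvar m' rBESTCOST 0 <= rvar m rBESTCOST 0 &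
    forall i u, rvar m' rBESTCOST 0 <=
      objective f (parts (rounding x p i (x (p u) u)))].
Proof.
move=> xF px mM mT best m'.
pose Inv (b : R) m := (rvar m rBESTCOST 0 = k%:R * f setT \/ recorded m) /\
  rvar m rBESTCOST 0 <= b.
pose Q i u m := recorded m /\ rvar m rBESTCOST 0 <=
      objective f (parts (rounding x p i (x (p u) u))).
pose b := rvar m rBESTCOST 0.
have u0 : V := t (Ordinal k0).
suff [[_ Ib] QQ] : Inv b m' /\ forall i, forall u, Q i u m'.
  split=> // [|i u]; last by have [] := QQ i u.
  by have [] := QQ (Ordinal k0) u0.
apply: (@for_each_part (Inv b) (fun i m => forall u, Q i u m) vI) => //.
move=> i m1 [sn1 sr1] m1I [best1 b1].
have : Inv (rvar m1 rBESTCOST 0) (den (For vT UpToCard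
    (Then rounding_prog (Then cost_prog record_prog))) m1) /\
  forall u, Q i u (den (For vT UpToCard
    (Then rounding_prog (Then cost_prog record_prog))) m1).
  apply: (@for_each_element (Inv (rvar m1 rBESTCOST 0)) (Q i) vT) => // u m2 [sn2 sr2] m2T [best2 b2].
  have [] := @search_body_spec m2 x p i u xF px _ _ _ m2T best2.
  - by move=> v; rewrite sn2 // sn1 // mM.
  - by move=> v; rewrite sr2 // sr1 // mT.
  - by rewrite sn2.
  move=> rec3 le_best3 cost3; split.
  - by split; [right|exact: le_trans le_best3 b2].
  - by [].
  - by move=> w wu [_ costw]; split=> //; exact: le_trans le_best3 costw.
move=> [[best2 b2] Q2]; split=> //.
  by split=> //; exact: le_trans b2 b1.
move=> j ji Qj u; split; first by have [] := Q2 u.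
by have [_] := Qj u; apply: le_trans.
Qed.

(** Each average is stored before its column is overwritten, and [rW] still holds the old weights,
    so updating in place agrees with [update]. *)
Lemma update_spec m x : constants m -> matrix_at rX m x ->
  matrix_at rW m (fun j => greedy f (x j)) ->
  matrix_at rX (den update_prog m) (update f x).
Proof.
move=> [mO _ mD] mX mW.
pose P l m := forall j v, rvar m rX (j * n + rank v) =
  if (rank v < l)%N then update f x j v else x j v.
suff H : P n (den update_prog m) by move=> j v; rewrite H rank_lt.
apply: (@den_for P vU UpToCard) => [//|//|l m1 ln [sn1 sr1] m1U P1].
have [v vl] := rankP ln; rewrite -{}vl {l ln} in m1U P1 *.
rewrite !den_then; set m2 := den _ m1.
have m2U : nvar m2 vU 0 = rank v by [].
have m2O : offsets m2 by move=> l lk; rewrite /m2 /= sn1 // mO.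
have m2X j : rvar m2 rX (j * n + rank v) = x j v by rewrite /m2 /= /put /= P1 ltnn.
have m2W j : rvar m2 rW (j * n + rank v) = greedy f (x j) v.
  by rewrite /m2 /= /put /= sr1.
set m3 := den _ m2.
have m3A : rvar m3 rAVG 0 = average f x v.
  pose P' l m := rvar m rAVG 0 =
    \sum_(j < k | (j < l)%N) x j v * greedy f (x j) v.
  have : P' k m3.
    apply: (@den_for P' vJ UpToK) => [|//|l m4 lk [sn4 sr4] m4J P4].
      by rewrite /P' /m2 /= big_pred0.
    rewrite /P' (bigD1 (Ordinal lk)) //= /put /= addrC.
    rewrite m4J !sn4 // m2O // m2U -[l]/(nat_of_ord (Ordinal lk)).
    rewrite P4 !sr4 // m2X m2W; congr (_ + _); apply: eq_bigl => j.
    by rewrite -val_eqE /= ltnS [RHS]andbC ltn_neqAle.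
  by rewrite /P' => ->; apply: eq_bigl => j; rewrite ltn_ord.
have m3U : nvar m3 vU 0 = rank v by rewrite nvar_den.
have m3O : offsets m3 by move=> l lk; rewrite nvar_den // m2O.
have m3X l : rvar m3 rX l = rvar m1 rX l by rewrite rvar_den.
have m3W j : rvar m3 rW (j * n + rank v) = greedy f (x j) v.
  by rewrite rvar_den // m2W.
have m3D : rvar m3 rDENOM 0 = step_denominator f by rewrite !rvar_den // sr1.
clearbody m3.
pose P' l m := forall j u, rvar m rX (j * n + rank u) =
  if (u == v) && (j < l)%N then update f x j v else rvar m1 rX (j * n + rank u).
have : P' k (den (For vJ UpToK
             (set_entry rX (nscal vJ) (nscal vU)
                (RTimes (entry rX (nscal vJ) (nscal vU))
                   (RPlus (OfNat (Cst 1))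
                      (ROver (RMinus (rscal rAVG) (entry rW (nscal vJ) (nscal vU)))
                             (rscal rDENOM)))))) m3).
  apply: (@den_for P' vJ UpToK) => [j u|//|l m4 lk [sn4 sr4] m4J P4 j u].
    by rewrite andbF m3X.
  have m4X : rvar m4 rX (Ordinal lk * n + rank v) = x (Ordinal lk) v.
    by rewrite P4 eqxx ltnn andbF P1 ltnn.
  rewrite /= /put /= m4J !sn4 // m3O // m3U -[l]/(nat_of_ord (Ordinal lk)).
  rewrite entry_eq m4X P4 !sr4 // m3A m3W m3D.
  rewrite -val_eqE /= ltnS [(j <= l)%N]leq_eqVlt andbC.
  case: (eqVneq u v) => [->|_] //=; case: eqP => //= jl.
  by have -> : j = Ordinal lk by exact: val_inj.
move=> H j u; rewrite H ltn_ord andbT ltnS leq_eqVlt rank_eq.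
by case: (eqVneq u v) => [-> //|_]; rewrite P1.
Qed.

Lemma constants_den q m : (OFFSET \notin nwritten q) ->
  (rFULL \notin rwritten q) -> (rDENOM \notin rwritten q) ->
  constants m -> constants (den q m).
Proof.
move=> qO qF qD [mO mF mD]; split; rewrite ?rvar_den //.
by move=> l lk; rewrite nvar_den // mO.
Qed.

Local Notation iterate s := (iter s (@update R V f k) (start R t)).

(** State after [s] rounds: the best cost is below every rounding of every earlier iterate, for the
    labelling the program chose there. *)
Record invariant (s : nat) m : Prop := Invariant {
  inv_constants : constants m;
  inv_iterate : matrix_at rX m (iterate s);
  inv_best : rvar m rBESTCOST 0 = k%:R * f setT \/ recorded m;
  inv_recorded : (0 < s)%N -> recorded m;
  inv_searched : forall r, (r < s)%N -> exists2 p, argmax (iterate r) p &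
    forall i u, rvar m rBESTCOST 0 <=
      objective f (parts (rounding (iterate r) p i (iterate r (p u) u))) }.

Lemma initialize_spec m : (forall l, nvar m OFFSET l = 0%N) ->
  invariant 0 (den initialize m).
Proof.
move=> m0; rewrite /initialize !den_then.
have := offsets_spec m0; set m1 := den _ m => m1O.
have := uniform_spec m1O; set m2 := den _ m1 => m2X.
have m2O : offsets m2 by move=> l lk; rewrite nvar_den // m1O.
have := terminals_spec m2O m2X; set m3 := den _ m2 => m3X.
have m3O : offsets m3 by move=> l lk; rewrite nvar_den // m2O.
clearbody m3; have allE : [set v | 0 <= 0]%N = [set: V].
  by apply/setP => v; rewrite !inE.
by split=> //; left; rewrite /= /put /= allE.
Qed.

Lemma round_spec s m : invariant s m -> invariant s.+1 (den round_prog m).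
Proof.
move=> [mC mX mB mR mS]; have xF := iter_fractional fN fM k0 tI s.
rewrite /round_prog !den_then; set m1 := den _ m.
have m1C : constants m1 by exact: constants_den.
have m1W : matrix_at rW m1 (fun j => greedy f (iterate s j)) by exact: greedy_spec.
have m1X : matrix_at rX m1 (iterate s) by move=> j v; rewrite rvar_den.
have [p px [m2M m2T]] := argmax_spec m1C m1X; set m2 := den _ m1 in m2M m2T *.
have m2C : constants m2 by exact: constants_den.
have m2B : rvar m2 rBESTCOST 0 = rvar m rBESTCOST 0 by rewrite !rvar_den.
have m2best : rvar m2 rBESTCOST 0 = k%:R * f setT \/ recorded m2.
  case: mB => [B|[q [lq qt Bq]]]; [left|right]; rewrite ?m2B //.
  by exists q; split=> //; [move=> v; rewrite !nvar_den // lq|rewrite m2B].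
have [m3R m3B m3S] := search_spec xF px m2M m2T m2best.
set m3 := den _ m2 in m3R m3B m3S *.
have m3C : constants m3 by exact: constants_den.
have m3X : matrix_at rX m3 (iterate s) by move=> j v; rewrite !rvar_den // m1X.
have m3W : matrix_at rW m3 (fun j => greedy f (iterate s j)).
  by move=> j v; rewrite rvar_den // rvar_den // m1W.
have m4B : rvar (den update_prog m3) rBESTCOST 0 = rvar m3 rBESTCOST 0.
  by rewrite rvar_den.
have m4R : recorded (den update_prog m3).
  case: m3R => q [lq qt Bq]; exists q; split=> //; last by rewrite m4B.
  by move=> v; rewrite nvar_den // lq.
split=> //; first exact: constants_den.
- exact: update_spec.
- by right.
move=> r; rewrite ltnS leq_eqVlt => /orP[/eqP ->|/mS[q qx qS]].
  by exists p => // i u; rewrite m4B.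
by exists q => // i u; rewrite m4B; apply: le_trans m3B _; rewrite m2B.
Qed.

Lemma invariant_putn s m z w : (9 < z)%N -> invariant s m ->
  invariant s (putn m z 0 w).
Proof.
move=> z9 [[mO mF mD] mX mB mR mS].
have E a l : (a <= 9)%N -> nvar (putn m z 0 w) a l = nvar m a l.
  by move=> a9; rewrite /= /put ifF //; apply/andP => -[/eqP az]; lia.
have rE : recorded m -> recorded (putn m z 0 w).
  by case=> q [lq qt Bq]; exists q; split=> // v; rewrite E.
split=> //.
- by split=> // l lk; rewrite E // mO.
- by case: mB => [|/rE]; [left|right].
- by move/mR/rE.
Qed.

Lemma invariant_for z b q c s m : (9 < z)%N ->
  (forall s m, invariant s m -> invariant (s + c) (den q m)) ->
  invariant s m -> invariant (s + evalbound V k b * c) (den (For z b q) m).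
Proof.
move=> z9 body inv.
apply: (@den_for (fun l m => invariant (s + l * c) m) z b).
- by rewrite mul0n addn0.
- by move=> l m' w; exact: invariant_putn.
- by move=> l m' _ _ _ /body; rewrite mulSn [(c + _)%N]addnC addnA.
Qed.

Lemma main_spec m : (forall l, nvar m OFFSET l = 0%N) ->
  invariant (iterations V) (den main_prog m).
Proof.
move=> m0; rewrite /main_prog den_then.
have -> : iterations V =
    (0 + 576 * (n * (n * (n * (n * (n * (n * 1)))))))%N.
  by rewrite /iterations !expnS expn0.
have inv0 := initialize_spec m0.
apply: (@invariant_for 10 (UpToCst 576)) inv0 => // s1 m1.
do 6! [apply: (@invariant_for _ UpToCard) => // {}s1 {}m1].
by rewrite addn1; exact: round_spec.
Qed.

Lemma main_approximation m : (forall l, nvar m OFFSET l = 0%N) ->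
  exists p, [/\ labels_at BEST (den main_prog m) p, forall i, p (t i) = i &
    forall W, feasible t W -> objective f (parts p) <= 4 / 3 * objective f W].
Proof.
move=> /main_spec [_ _ _ mR mS].
have [p [lp pt Bp]] := mR (iterations_gt0 k0 tI).
exists p; split=> // W /(feasible_parts k0)[c ct ->].
have [s [i [sT ap]]] := approximation fN fM fS k0 tI ct.
have [q qx qS] := mS s sT; have [u] := ap q qx.
by apply: le_trans; rewrite -Bp.
Qed.

End Verification.

(** * Initial store, output and halting *)

Section Execution.
Variables (R : realType) (V : finType) (f : {set V} -> R).
Variables (k : nat) (t : 'I_k -> V).
Hypothesis k0 : (0 < k)%N.
Hypothesis tI : injective t.
Local Notation n := #|V|.
Local Notation rank v := (nat_of_ord (enum_rank v)).

Lemma parts_feasible p : (forall i, p (t i) = i) -> feasible t (parts p).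
Proof.
move=> pt; apply/and3P; split.
- by apply/forallP => i; rewrite ffunE inE pt.
- apply/forallP => i; apply/forallP => j; apply/implyP => ij.
  rewrite !ffunE -setI_eq0; apply/eqP/setP => v; rewrite !inE.
  by apply: contraNF ij => /andP[/eqP <- /eqP <-].
- apply/eqP/setP => v; rewrite inE; apply/bigcupP; exists (p v) => //.
  by rewrite ffunE inE.
Qed.

(** Raw cell contents, because [represents] constrains all indices below [#|V|], including those
    from [k] on. *)
Definition terminal_cell (i : nat) : nat := ncell (init_store R t) (2 + i).

Lemma terminal_cellE (i : 'I_k) : terminal_cell i = rank (t i).
Proof.
rewrite /terminal_cell /= (nth_map i) ?size_enum_ord ?ltn_ord //.
by rewrite nth_ord_enum.
Qed.

Lemma init_represents :
  represents V k terminal_cell (init_store R t)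
    (Memory (fun _ _ => 0%N) (fun _ _ => 0)).
Proof.
(* The arrays start at 2 n + 2, past the k + 2 input cells as k <= n, and hence read the default
   0. *)
have kn := k_le_cardV tI; split=> // a i a32.
rewrite [LHS]/= nth_default //= size_map size_enum_ord; set N := #|V| in kn *; lia.
Qed.

(* Unifies the convertible but syntactically distinct instances of the
   cardinal of V, which lia would treat as different atoms. *)
Ltac card_lia :=
  repeat match goal with H : is_true _ |- _ => revert H end;
  match goal with V : finType |- _ => set N := #|V| end; lia.

Lemma output_steps term (s : store R) (m : memory R) (p : V -> 'I_k) :
  represents V k term s m -> labels_at 3 m p ->
  steps f output_cmd s (4 * n + 1) (fun s' => forall v, ncell s' (rank v) = p v).
Proof.
have n0 := cardV_gt0 k0 tI.
move=> rep lp.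
pose z := (n + n + (2 + 17 + 32 * 0))%N.
pose best (l : nat) := (n + n + (2 + 3 + 32 * l))%N.
(* After [i] passes the cells above n - 1 - i hold their output, while cell 0 still holds n. *)
pose Inv (i : nat) (s : store R) := [/\ ncell s 0 = n, ncell s z = (n.-1 - i)%N,
  forall v, ncell s (best (rank v)) = p v &
  forall v, (n.-1 - i < rank v)%N -> ncell s (rank v) = p v].
have addrE a e (s' : store R) : ncell s' 0 = n ->
    neval s' (naddr a e) = (n + n + (2 + a + 32 * neval s' e))%N.
  by move=> s0; rewrite /naddr -neval_times32 /= s0.
have zE (s' : store R) : ncell s' 0 = n -> neval s' (naddr 17 (NConst 0)) = z.
  by move=> s0; rewrite addrE.
have getz (s' : store R) : ncell s' 0 = n ->
    neval s' (NGet (naddr 17 (NConst 0))) = ncell s' z.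
  by move=> s0; rewrite -(zE _ s0).
have getbest e (s' : store R) : ncell s' 0 = n ->
    neval s' (NGet (naddr 3 e)) = ncell s' (best (neval s' e)).
  by move=> s0; rewrite /best -(addrE 3 e _ s0).
have s0 := rep_card rep.
pose s1 := nset s z n.-1.
have inv0 : Inv 0%N s1.
  split.
  - by rewrite /= /upd ifF // /z; card_lia.
  - by rewrite /= /upd eqxx subn0.
  - by move=> v; rewrite /= /upd ifF ?(rep_nvar rep) ?lp // /best /z; card_lia.
  - by move=> v; have := ltn_ord (enum_rank v); rewrite subn0=> vn h; card_lia.
apply: (@steps_weaken _ _ _ _ _ (1 + ((n.-1 * (1 + 1).+1.+1).+1 + 1).+1).+1) => //.
- by card_lia.
- exact: (fun s' H => H).
apply: (@steps_seq _ _ _ _ _ _ 1 _ (eq s1)).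
  apply: (steps_one (s' := s1)) => // cs c.
  by rewrite [LHS]/= -/(naddr _ _) s0 /s1 subn1.
move=> _ <-; apply: (@steps_seq _ _ _ _ _ _ _ 1 (Inv n.-1)).
  apply: (steps_while (I := Inv)) => // i s2 ilt [s20 s2z s2b s2o].
    transitivity (1 <= neval s2 (NGet (naddr 17 (NConst 0))))%N; first by [].
    by rewrite getz // s2z; card_lia.
  pose s3 := nset s2 (n.-1 - i)%N (ncell s2 (best (n.-1 - i)%N)).
  apply: (@steps_seq _ _ _ _ _ _ 1 1 (eq s3)).
    apply: (steps_one (s' := s3)) => // cs c.
    rewrite /s3 -s2z -(getz _ s20) -(getbest _ _ s20).
    by [].
  move=> _ <-.
  have s30 : ncell s3 0 = n by rewrite /= /upd ifF //; card_lia.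
  have s3z : ncell s3 z = (n.-1 - i)%N by rewrite /= /upd ifF // /z; card_lia.
  apply: (steps_one (s' := nset s3 z (n.-1 - i.+1)%N)) => [|cs c].
    split.
    - by rewrite /= /upd ifF ?s30 // /z; card_lia.
    - by rewrite /= /upd eqxx.
    - by move=> v; rewrite /= /upd !ifF ?s2b // /best /z; card_lia.
    - move=> v vi; have := ltn_ord (enum_rank v); move=> vn.
      rewrite /= /upd ifF; last by rewrite /z; card_lia.
      case: ifPn => [/eqP <-|vn1]; first by rewrite s2b.
      by rewrite s2o //; card_lia.
  transitivity (cs, nset s3 (neval s3 (naddr 17 (NConst 0)))
    (neval s3 (NGet (naddr 17 (NConst 0))) - 1)%N); first by [].
  by rewrite zE // getz // s3z; congr (_, nset _ _ _); card_lia.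
move=> s4 [s40 s4z s4b s4o].
apply: (steps_one (s' := nset s4 0 (ncell s4 (best 0)))) => [v|cs c].
  rewrite /= /upd; case: eqP => [v0|/eqP v0]; first by have := s4b v; rewrite v0.
  by rewrite s4o // subnn lt0n.
transitivity (cs, nset s4 0 (neval s4 (NGet (naddr 3 (NConst 0))))); first by [].
by rewrite getbest.
Qed.

(** A halted configuration is a fixed point of [step], so surplus coins change nothing. *)
Lemma run_steps p time Q : steps f p (init_store R t) time Q ->
  forall r : seq bool, (time <= size r)%N ->
    halted (run f t p r) /\ Q (run f t p r).2.
Proof.
case=> m [s [mt Qs go]] r tr.
have stay (l : seq bool) : foldl (step f) ([::], s) l = ([::], s).
  by elim: l.
suff -> : run f t p r = ([::], s) by [].
rewrite /run -(cat_take_drop m r) foldl_cat go ?stay //.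
by rewrite size_takel // (leq_trans mt).
Qed.

End Execution.

(** The added 6 covers the output phase and the outer [Seq]: 4 n + 2 <= 6 n. *)
Definition time_factor := (cost_factor main_prog + 6)%N.
Definition time_degree := cost_degree main_prog.

Theorem theorem1p1 (R : realType) :
  exists (p : cmd) (c d : nat),
    forall (V : finType) (f : {set V} -> R) (k : nat) (t : 'I_k -> V),
      nonneg_setfun f -> normalized_setfun f ->
      monotone_setfun f -> submodular_setfun f ->
      (0 < k)%N -> injective t ->
      let T := (c * #|V| ^ d)%N in
      (forall r : T.-tuple bool,
          halted (run f t p r) /\ feasible t (output k (run f t p r))) /\
      expectation_coins
        (fun r : T.-tuple bool => objective f (output k (run f t p r)))
        <= 4 / 3 * opt f t.
Proof.
exists algorithm, time_factor, time_degree => V f k t _ fN fM fS k0 tI T.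
have n0 := cardV_gt0 k0 tI; have kn := k_le_cardV tI.
pose m0 : memory R := Memory (fun _ _ => 0%N) (fun _ _ => 0).
have [p [lp pt p_opt]] := main_approximation fN fM fS k0 tI
  (@terminal_cellE R V k t) (m := m0) (fun=> erefl).
have wf_main : wf main_prog by [].
have init := init_represents R k0 tI.
have all_steps : steps f algorithm (init_store R t)
    (cost V k main_prog + (4 * #|V| + 1)).+1
    (fun s => forall v, ncell s (enum_rank v) = p v).
  apply: steps_seq (compile_correct f n0 wf_main init) _ => s rep.
  exact: (output_steps f k0 tI rep lp).
have time_ok (r : T.-tuple bool) :
    ((cost V k main_prog + (4 * #|V| + 1)).+1 <= size r)%N.
  have := cost_polynomial main_prog n0 kn.
  rewrite size_tuple /T /time_factor mulnDl => main_ok.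
  have : (#|V| <= #|V| ^ time_degree)%N.
    by rewrite -[X in (X <= _)%N]expn1 leq_pexp2l.
  by move: main_ok; rewrite -/time_degree; move: (#|V| ^ time_degree)%N; lia.
have out (r : T.-tuple bool) :
    halted (run f t algorithm r) /\ output k (run f t algorithm r) = parts p.
  have [hr pr] := run_steps all_steps (time_ok r); split=> //.
  by apply/ffunP => i; rewrite !ffunE; apply/setP => v; rewrite !inE pr val_eqE.
split=> [r|].
  by have [hr ->] := out r; split=> //; exact: parts_feasible.
have [W fW [-> _]] := opt_attained f k0 tI.
(* Every coin sequence yields [parts p], so this is the average of a constant over 2^T sequences. *)
rewrite /expectation_coins.
under eq_bigr => r _ do rewrite (out r).2.
rewrite sumr_const card_tuple card_bool -[objective f (parts p) *+ _]mulr_natr natrX.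
by rewrite mulfK ?expf_neq0 ?pnatr_eq0 //; exact: p_opt.
Qed.
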